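(* There is a function $f:\mathbb{N}\to\mathbb{N}$ such that, for every positive integer $k$, every simple permutation of length at least $f(k)$ contains two simple subsequences, each of length at least $k$, which share at most two entries.
   Context: A permutation $\pi$ of $[n]=\{1,\dots,n\}$ is written as the sequence $\pi(1)\pi(2)\cdots\pi(n)$. An interval of $\pi$ is a set of contiguous indices $I=[a,b]$ such that $\pi(I)=\{\pi(i):i\in I\}$ is a set of consecutive integers. Every permutation of $[n]$ has intervals of size $0$, $1$ and $n$; $\pi$ is simple if it has no other intervals. Every finite sequence of distinct real numbers is order isomorphic to a unique permutation (the permutation with the same relative comparisons); such a sequence is called simple if the permutation it is order isomorphic to is simple. A subsequence of $\pi$ is $\pi(i_1)\pi(i_2)\cdots\pi(i_\ell)$ with $i_1<\dots<i_\ell$; two subsequences share the entries whose indices they have in common. *)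

(* Defs.v *)
From mathcomp Require Import all_boot all_fingroup.

Set Implicit Arguments.
Unset Strict Implicit.
Unset Printing Implicit Defensive.

(* Permutations of [n] are elements of 'S_n, so both indices and values run
   over 0, ..., n-1 instead of 1, ..., n. *)

(* Taking a > b gives the empty set. *)
Definition contiguous n (A : {set 'I_n}) : Prop :=
  exists a b : nat, A = [set i : 'I_n | a <= i <= b].

Definition perm_interval n (p : 'S_n) (I : {set 'I_n}) : Prop :=
  contiguous I /\ contiguous (p @: I).

Definition simple_perm n (p : 'S_n) : Prop :=
  forall I : {set 'I_n}, perm_interval p I -> #|I| \in [:: 0; 1; n].

Definition order_isomorphic (s : seq nat) (q : 'S_(size s)) : Prop :=
  forall i j : 'I_(size s), (nth 0 s i < nth 0 s j) = (q i < q j).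

(* For a sequence of distinct numbers there is exactly one such q; for a
   sequence with a repetition there is none. *)
Definition simple_seq (s : seq nat) : Prop :=
  exists2 q : 'S_(size s), order_isomorphic q & simple_perm q.

(* A subsequence is given by its set of indices S: [enum S] lists S in
   increasing order. *)
Definition subsequence n (p : 'S_n) (S : {set 'I_n}) : seq nat :=
  [seq val (p i) | i <- enum S].

(* Main.v *)
(* A set is simple when every subset with at least two points is cut by a
   further point of the set, i.e. one whose abscissa or ordinate separates two
   of its points.  Starting from a pair and repeatedly adding all cutting
   points, one reaches everything.

   If this takes many steps for some pair, one extracts a long proper pin
   sequence; each half of it is simple up to two points.

   Otherwise a fixed point x is reached in few steps from each of many pairs of
   neighbouring points.  Going back from x, either many pairs share the
   previous point u, and we replace x by u, or many different points u, all on
   the same side of x, cut different sets lying on the other side of x.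
   Choosing the u greedily, none of them cuts the sets chosen later, so we
   obtain two rows of points alternating along a line.  By Ramsey's theorem
   both rows may be taken monotone.  If they are parallel, they are simple.  If
   they form a wedge, the set reached from the innermost pair jumps over many
   layers in a single step; the points responsible, at most two of them, make
   this part of the wedge simple, and they are the only points shared by its
   two halves. *)
Require Import Defs.
From mathcomp Require Import all_boot all_fingroup all_order all_algebra.
From mathcomp Require Import zify.
From Stdlib Require Import ClassicalEpsilon.

Set Implicit Arguments.
Unset Strict Implicit.
Unset Printing Implicit Defensive.

(** * Cutting points and simple sets *)

Lemma lt_flip (x a t : int) : x != a -> x != t ->
  (x < a)%R = (x < t)%R -> (a < x)%R = (t < x)%R.
Proof. lia. Qed.

Section Closure.

Variable T : finType.
Implicit Types (X Y : T -> int) (A B S M N : {set T}) (a b c z : T).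

(** A point set in the plane is a finite type with two coordinate functions. As [X] and [Y] are
    arguments, reflections and the exchange of axes act by changing them. *)
Definition cut X Y z A : bool :=
  [exists a in A, exists b in A,
    (X a < X z < X b)%R || (Y a < Y z < Y b)%R].

(** These are the intervals of the permutation induced by [S], phrased through cuts so that no ranks
    inside [S] have to be computed. *)
Definition module X Y S M : Prop :=
  M \subset S /\ forall z, z \in S -> cut X Y z M -> z \in M.

Definition simple X Y S : Prop :=
  forall M, module X Y S M -> 1 < #|M| -> M = S.

Definition grow X Y A : {set T} := A :|: [set z | cut X Y z A].

Definition level X Y t a b : {set T} := iter t (grow X Y) [set a; b].

Definition good X Y k : Prop :=
  exists S1 S2 : {set T},
    [/\ simple X Y S1 /\ k <= #|S1|, simple X Y S2 /\ k <= #|S2|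
      & #|S1 :&: S2| <= 2].

Lemma cutP X Y z A :
  reflect (exists a b, [/\ a \in A, b \in A &
             (X a < X z < X b)%R || (Y a < Y z < Y b)%R]) (cut X Y z A).
Proof.
apply: (iffP exists_inP) => [[a aA /exists_inP[b bA h]]|[a [b [aA bA h]]]].
  by exists a, b.
by exists a => //; apply/exists_inP; exists b.
Qed.

Lemma cutX X Y z A a b :
  a \in A -> b \in A -> (X a < X z < X b)%R -> cut X Y z A.
Proof. by move=> aA bA h; apply/cutP; exists a, b; rewrite h. Qed.

Lemma cutY X Y z A a b :
  a \in A -> b \in A -> (Y a < Y z < Y b)%R -> cut X Y z A.
Proof. by move=> aA bA h; apply/cutP; exists a, b; rewrite h orbT. Qed.

Lemma cut_sub X Y z A B : A \subset B -> cut X Y z A -> cut X Y z B.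
Proof.
move=> /subsetP AB /cutP[a [b [aA bA h]]].
by apply/cutP; exists a, b; rewrite !AB.
Qed.

Lemma cut_swap X Y z A : cut Y X z A = cut X Y z A.
Proof.
by apply/cutP/cutP => -[a [b [aA bA h]]]; exists a, b; rewrite orbC.
Qed.

Lemma cut_opp X Y z A : cut (fun t => - X t)%R Y z A = cut X Y z A.
Proof.
apply/cutP/cutP => -[a [b [aA bA /orP[h|h]]]].
- by exists b, a; split=> //; apply/orP; left; lia.
- by exists a, b; rewrite h orbT.
- by exists b, a; split=> //; apply/orP; left; lia.
- by exists a, b; rewrite h orbT.
Qed.

Section Transfer.

Variables X Y X' Y' : T -> int.
Hypothesis eq_cut : forall z A, cut X' Y' z A = cut X Y z A.

(** Levels, modules and simplicity see the coordinates only through [cut], so a symmetry that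
    preserves [cut] may be applied without loss of generality. *)
Lemma level_transfer t a b : level X' Y' t a b = level X Y t a b.
Proof.
elim: t => //= t ->; rewrite /grow; congr (_ :|: _).
by apply/setP=> z; rewrite !inE eq_cut.
Qed.

Lemma simple_transfer S : simple X' Y' S -> simple X Y S.
Proof.
move=> sS M [MS cM]; apply: sS; split=> // z zS; rewrite eq_cut; exact: cM.
Qed.

Lemma good_transfer k : good X' Y' k -> good X Y k.
Proof.
by move=> [S1 [S2 [[h1 h2] [h3 h4] h5]]]; exists S1, S2; do !split=> //;
  apply: simple_transfer.
Qed.

End Transfer.

Lemma cut_oppr X Y z A : cut X (fun t => - Y t)%R z A = cut X Y z A.
Proof. by rewrite cut_swap cut_opp cut_swap. Qed.

Lemma cut_opp2 X Y z A :
  cut (fun t => - X t)%R (fun t => - Y t)%R z A = cut X Y z A.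
Proof. by rewrite cut_opp cut_oppr. Qed.

Lemma simple_setT_grow X Y A :
  simple X Y setT -> 1 < #|A| -> A != setT -> exists2 z, z \in grow X Y A & z \notin A.
Proof.
move=> sT A1 AT; case: (boolP [exists z, (z \in grow X Y A) && (z \notin A)]).
  by case/existsP=> z /andP[? ?]; exists z.
move=> /existsPn nz; case/eqP: AT; apply: sT => //; split; first exact: subsetT.
by move=> z _ cz; move: (nz z); rewrite !inE cz orbT /= negbK.
Qed.

Lemma sub_grow X Y A : A \subset grow X Y A.
Proof. exact: subsetUl. Qed.

Lemma level_sub X Y s t a b : s <= t -> level X Y s a b \subset level X Y t a b.
Proof.
move/subnK<-; elim: (t - s) => //= m IH.
exact: (subset_trans IH (sub_grow _ _ _)).
Qed.

Lemma level0 X Y t a b : (a \in level X Y t a b) * (b \in level X Y t a b).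
Proof.
have /subsetP h := @level_sub X Y 0 t a b isT.
by rewrite !h // !inE eqxx ?orbT.
Qed.

(** * Restoring simplicity by deleting at most two points *)

Section Core.

Variables X Y : T -> int.

Lemma module_trans S M N : module X Y S M -> module X Y M N -> module X Y S N.
Proof.
move=> [MS cM] [NM cN]; split; first exact: (subset_trans NM).
move=> z zS cz; apply: cN => //; apply: cM => //; exact: cut_sub cz.
Qed.

Hypotheses (injX : injective X) (injY : injective Y).

(** No other point of [S] tells the twins [a] and [t] apart. Hence a module of [S :\ a] avoiding [t]
    is a module of [S], against the hypothesis; one containing [t] becomes a module of [S] with at
    least three points once [a] is added, so it is everything. *)
Lemma simple_remove_twin S a t :
  module X Y S [set a; t] -> a != t -> 2 < #|S| ->
  (forall M, module X Y S M -> 1 < #|M| -> t \in M /\ (#|M| = 2 \/ M = S)) ->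
  simple X Y (S :\ a).
Proof.
move=> [/subsetP atS mat] nat S3 H N [/subsetP NS cN] N2.
have aS : a \in S by apply: atS; rewrite !inE eqxx.
have tS : t \in S by apply: atS; rewrite !inE eqxx orbT.
have aN : a \notin N by apply/negP=> /NS; rewrite !inE eqxx.
have sepX e : e \in S -> e != a -> e != t -> (X e < X a)%R = (X e < X t)%R.
  move=> eS ea et; have : e \notin [set a; t] by rewrite !inE negb_or ea.
  have : X e != X a by rewrite (inj_eq injX).
  have : X e != X t by rewrite (inj_eq injX).
  move=> h1 h2; apply: contraNeq => h3; apply: mat => //.
  have [h4|h4] : (X a < X e < X t \/ X t < X e < X a)%R by lia.
    by apply: (cutX _ (a := a) (b := t)); rewrite ?inE ?eqxx ?orbT.
  by apply: (cutX _ (a := t) (b := a)); rewrite ?inE ?eqxx ?orbT.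
have sepY e : e \in S -> e != a -> e != t -> (Y e < Y a)%R = (Y e < Y t)%R.
  move=> eS ea et; have : e \notin [set a; t] by rewrite !inE negb_or ea.
  have : Y e != Y a by rewrite (inj_eq injY).
  have : Y e != Y t by rewrite (inj_eq injY).
  move=> h1 h2; apply: contraNeq => h3; apply: mat => //.
  have [h4|h4] : (Y a < Y e < Y t \/ Y t < Y e < Y a)%R by lia.
    by apply: (cutY _ (a := a) (b := t)); rewrite ?inE ?eqxx ?orbT.
  by apply: (cutY _ (a := t) (b := a)); rewrite ?inE ?eqxx ?orbT.
have [tN|tN] := boolP (t \in N); last first.
  suff mN : module X Y S N by have [] := H _ mN N2; rewrite (negbTE tN).
  split; first by apply/subsetP=> z /NS; rewrite !inE => /andP[].
  move=> z zS cz; have [za|za] := eqVneq z a; last by apply: cN; rewrite // !inE za.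
  (* If [a] cut [N], so would its twin [t], which would then belong to [N]. *)
  case/negP: (tN); apply: cN; first by rewrite !inE eq_sym nat.
  case/cutP: cz => e [f [eN fN]]; rewrite za => h.
  have /setD1P[ea eS] := NS _ eN; have /setD1P[fa fS] := NS _ fN.
  case: (eqVneq e t) => [et|et]; first by rewrite -et eN in tN.
  case: (eqVneq f t) => [ft|ft]; first by rewrite -ft fN in tN.
  have := sepX _ eS ea et; have := sepX _ fS fa ft.
  have := sepY _ eS ea et; have := sepY _ fS fa ft.
  move=> fY eY fX eX; apply/cutP; exists e, f; split=> //.
  rewrite -eX -eY -(@lt_flip (X f) (X a) (X t)) ?(inj_eq injX) //.
  by rewrite -(@lt_flip (Y f) (Y a) (Y t)) ?(inj_eq injY).
have mN : module X Y S (a |: N).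
  split; first by apply/subsetP=> z; rewrite !inE => /predU1P[->|/NS/setD1P[]].
  move=> z zS cz; rewrite !inE; case: eqVneq => //= za.
  have [->//|zt] := eqVneq z t.
  apply: cN; first by rewrite !inE za.
  (* In a cutting pair [a] may be replaced by [t], as [z] does not separate the twins. *)
  have toN e : e \in a |: N -> exists2 e', e' \in N &
      ((X e < X z) = (X e' < X z))%R /\ ((Y e < Y z) = (Y e' < Y z))%R.
    rewrite !inE => /predU1P[->|eN]; last by exists e.
    exists t => //; split.
      by apply: lt_flip; rewrite ?(inj_eq injX) ?sepX.
    by apply: lt_flip; rewrite ?(inj_eq injY) ?sepY.
  case/cutP: cz => e [f [/toN[e' eN [e1 e2]] fA h]].
  have toN' : exists2 f', f' \in N &
      ((X z < X f) = (X z < X f'))%R /\ ((Y z < Y f) = (Y z < Y f'))%R.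
    move: fA; rewrite !inE => /predU1P[->|fN]; last by exists f.
    by exists t; rewrite ?sepX ?sepY //; split; rewrite ?(sepX z) ?(sepY z).
  case: toN' => f' fN [f1 f2].
  by apply/cutP; exists e', f'; split=> //; rewrite -e1 -e2 -f1 -f2.
have [_ [h|h]] := H _ mN (leq_trans N2 (subset_leq_card (subsetUr _ _))).
  by move: h; rewrite cardsU1 aN; lia.
apply/setP=> z; rewrite -h !inE; case: eqVneq => //= ->.
by rewrite (negbTE aN).
Qed.

(** If some module has one point less than [S], pass to it: its modules are modules of [S]. If a
    two-point module is left, it contains [t], and its other point is deleted. Each move costs at
    most one point. *)
Lemma simple_core (S : {set T}) t :
  4 < #|S| ->
  (forall M, module X Y S M -> 1 < #|M| ->
     t \in M /\ (#|M| = 2 \/ #|S| <= #|M|.+1)) ->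
  exists2 S' : {set T}, S' \subset S & simple X Y S' /\ #|S| <= #|S'| + 2.
Proof.
move=> S5 H.
have [S1 [S1S cS1 H1]] : exists S1, [/\ S1 \subset S, #|S| <= #|S1|.+1 &
    forall M, module X Y S1 M -> 1 < #|M| -> t \in M /\ (#|M| = 2 \/ M = S1)].
  have [ex|nex] := classic (exists2 M, module X Y S M & #|M|.+1 = #|S|).
    case: ex => M mM cM; exists M; split=> //; [exact: mM.1|by rewrite cM|].
    move=> N mN N1; have [tN [|h]] := H _ (module_trans mM mN) N1; split; auto.
    by right; apply/eqP; rewrite eqEcard mN.1; lia.
  exists S; split=> // M mM M1; have [tM [|h]] := H _ mM M1; split; auto.
  right; apply/eqP; rewrite eqEcard mM.1 /=.
  rewrite leqNgt; apply/negP=> lt; apply: nex; exists M => //; lia.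
have [ex|nex] := classic (exists2 M, module X Y S1 M & #|M| = 2).
  case: ex => M mM cM; have [tM _] := H1 _ mM ltac:(by rewrite cM).
  have [a aM] : exists a, M = [set a; t] /\ a != t.
    case/eqP/cards2P: cM => x [y [xy Mxy]].
    move: tM; rewrite Mxy !inE => /orP[/eqP->|/eqP->]; last by exists x.
    by exists y; rewrite setUC eq_sym.
  case: aM => Ma nat; exists (S1 :\ a).
    exact: subset_trans (subsetDl _ _) S1S.
  split; last by have := cardsD1 a S1; case: (a \in S1); lia.
  by apply: (@simple_remove_twin _ _ t) => //; rewrite -?Ma //; lia.
exists S1 => //; split; last lia.
move=> M mM M1; have [_ [h|//]] := H1 _ mM M1.
by case: nex; exists M.
Qed.

End Core.
End Closure.

(** * Pin sequences *)

Section Chains.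

Variables (T : finType) (X Y : T -> int).
Hypotheses (injX : injective X) (injY : injective Y).
Implicit Types (A S M : {set T}) (a b z : T) (p : nat -> T).

(** The quadrant around [a] that contains [z]. For [z] different from [a] and [b], these quadrants
    differ for [a] and [b] exactly when [z] cuts the pair. *)
Definition side a z : bool * bool := ((X a < X z)%R, (Y a < Y z)%R).

Lemma cut_side A a b z :
  a \in A -> b \in A -> z \notin A -> side a z != side b z -> cut X Y z A.
Proof.
move=> aA bA zA; have az : X a != X z /\ Y a != Y z.
  by rewrite (inj_eq injX) (inj_eq injY); case: eqP aA zA => // -> ->.
have bz : X b != X z /\ Y b != Y z.
  by rewrite (inj_eq injX) (inj_eq injY); case: eqP bA zA => // -> ->.
rewrite xpair_eqE negb_and => h.
have : (X a < X z < X b \/ X b < X z < X a \/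
        Y a < Y z < Y b \/ Y b < Y z < Y a)%R by case: az bz => ? ? [? ?]; lia.
case=> [|[|[|]]]; [exact: cutX|exact: cutX|exact: cutY|exact: cutY].
Qed.

Lemma side_cut A z : cut X Y z A ->
  exists a b, [/\ a \in A, b \in A & side a z != side b z].
Proof.
case/cutP=> a [b [aA bA h]]; exists a, b; split=> //.
by rewrite xpair_eqE negb_and; lia.
Qed.

Lemma side_flip a b z : a != z -> b != z ->
  side a z = side b z -> side z a = side z b.
Proof.
have flip (x y t : int) : x != t -> y != t ->
  (x < t)%R = (y < t)%R -> (t < x)%R = (t < y)%R by lia.
by move=> az bz [h1 h2]; congr (_, _); apply: flip;
  rewrite ?(inj_eq injX) ?(inj_eq injY).
Qed.

(* A proper pin sequence: the point at position [j] lies on the same side of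
   all points before position [j - 1] and separates them from its
   predecessor. *)
Definition chain p m : Prop :=
  [/\ forall i j, i < j -> j < m -> p i != p j,
      forall i i' j, i.+1 < j -> i'.+1 < j -> j < m ->
        side (p i) (p j) = side (p i') (p j)
    & forall i j, i.+1 < j -> j < m -> side (p i) (p j) != side (p j.-1) (p j)].

Lemma chain_shift p m s : chain p (s + m) -> chain (fun i => p (s + i)) m.
Proof.
move=> [c1 c2 c3]; split=> [i j ij jm|i i' j ij ij' jm|i j ij jm].
- by apply: c1; lia.
- by apply: c2; lia.
- rewrite /=; have -> : s + j.-1 = (s + j).-1 by lia.
  by apply: c3; lia.
Qed.

Lemma chain_trunc p m s : s <= m -> chain p m -> chain p s.
Proof.
move=> sm [c1 c2 c3]; split=> [i j ij jm|i i' j ij ij' jm|i j ij jm].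
- by apply: c1; lia.
- by apply: c2; lia.
- by apply: c3; lia.
Qed.

Definition chain_set p m : {set T} := [set p i | i : 'I_m].

Lemma mem_chain_set p m i : i < m -> p i \in chain_set p m.
Proof. by move=> im; apply/imsetP; exists (Ordinal im). Qed.

Lemma card_chain_set p m : chain p m -> #|chain_set p m| = m.
Proof.
move=> [c1 _ _]; rewrite card_imset ?card_ord // => i j /eqP.
case: (ltngtP i j) => [ij|ji|/val_inj//].
  by rewrite (negbTE (c1 _ _ ij (ltn_ord j))).
by rewrite eq_sym (negbTE (c1 _ _ ji (ltn_ord i))).
Qed.

(** Two points [p i], [p j] of [M] with [i < j] draw in all pins after [j], since each separates its
    predecessor from [p i]. Either [j] is always the last index and [M] is a pair, or the least
    possible [j] is at most 2 and at most one pin is missed. *)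
Lemma chain_module p m M :
  chain p m -> module X Y (chain_set p m) M -> 1 < #|M| ->
  p m.-1 \in M /\ (#|M| = 2 \/ m <= #|M|.+1).
Proof.
move=> [c1 c2 c3] [/subsetP MS cM] M2.
have pM z : z \in M -> exists2 i, i < m & z = p i.
  by move/MS/imsetP=> [i _ ->]; exists i.
have nM a b l : l < m -> a \in M -> b \in M -> p l \notin M ->
    side (p l) a = side (p l) b.
  move=> lm aM bM lM; apply: side_flip.
  - by apply: contraNneq lM => <-.
  - by apply: contraNneq lM => <-.
  apply/eqP/negPn/negP=> h; case/negP: (lM); apply: cM; last exact: cut_side h.
  exact: mem_chain_set.
have up i j l : i < j -> p i \in M -> p j \in M -> j <= l -> l < m -> p l \in M.
  move=> ij iM jM; elim: l => [|l IH]; first by rewrite leqn0 => /eqP<-.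
  rewrite leq_eqVlt => /predU1P[<-//|jl] lm.
  have lM : p l \in M by apply: IH; lia.
  apply/negPn/negP=> l1M; case/negP: (l1M); apply: cM; first exact: mem_chain_set.
  by apply: cut_side iM lM l1M (c3 _ _ _ lm); lia.
have [i [j [ij jm iM jM]]] : exists i j, [/\ i < j, j < m, p i \in M & p j \in M].
  case/card_gt1P: M2 => x [y [xM yM xy]].
  have [i im xi] := pM _ xM; have [j jm yj] := pM _ yM; subst.
  case: (ltngtP i j) => [ij|ji|eij]; [by exists i, j|by exists j, i|].
  by rewrite eij eqxx in xy.
have tM : p m.-1 \in M by apply: (up i j) => //; lia.
split=> //.
have [ex|nex] := classic (exists2 j, j.+1 < m & p j \in M /\ exists2 i, i < j & p i \in M); last first.
  left; suff -> : M = [set p i; p j] by rewrite cards2 c1.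
  have last_ix i' j' : i' < j' -> j' < m -> p i' \in M -> p j' \in M -> j' = m.-1.
    move=> ij' jm' iM' jM'; have [lt|] := boolP (j'.+1 < m); last lia.
    by case: nex; exists j' => //; split=> //; exists i'.
  have jE := last_ix _ _ ij jm iM jM.
  apply/eqP; rewrite eqEsubset; apply/andP; split; last first.
    by apply/subsetP=> z; rewrite !inE => /orP[]/eqP->.
  apply/subsetP=> z zM; have [l lm zl] := pM _ zM; rewrite !inE.
  have [il|li|->] := ltngtP i l; last by rewrite zl eqxx.
    by rewrite zl (last_ix _ _ il lm) -?zl // jE eqxx orbT.
  have := last_ix _ _ li (ltn_trans ij jm); rewrite -zl => /(_ zM iM); lia.
right; move: {i j ij jm iM jM} ex => exb.
have exb' : exists j, [&& j.+1 < m, p j \in M & [exists i : 'I_j, p i \in M]].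
  case: exb => j jm [jM [i ij iM]]; exists j; rewrite jm jM /=.
  by apply/existsP; exists (Ordinal ij).
(* By minimality of [j], no pin before [p j] other than [p i] belongs to [M]. *)
case: (ex_minnP exb') => j /and3P[jm jM /existsP[[i ij] /= iM]] jmin.
have out l : l < j -> l != i -> p l \notin M.
  move=> lj li; apply/negP=> lM.
  case: (ltngtP i l) => [il|li'|e]; last by rewrite e eqxx in li.
    have := jmin l; rewrite lM (_ : l.+1 < m) /=; last lia.
    have -> : [exists k : 'I_l, p k \in M] by apply/existsP; exists (Ordinal il).
    by move=> /(_ isT); lia.
  have := jmin i; rewrite iM (_ : i.+1 < m) /=; last lia.
  have -> : [exists k : 'I_i, p k \in M] by apply/existsP; exists (Ordinal li').
  by move=> /(_ isT); lia.
have j1M : p j.+1 \in M by apply: (up i j).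
(* For [3 <= j], choose two pins before [p j] outside [M]. The pin [p j.+1] lies on the same side of
   both, hence so does all of [M]; but [p i] (if [i = j - 1]) or [p j] (otherwise) separates
   them. *)
have [j3|j2] := leqP 3 j.
  have [ij1|ij1] := ltnP i.+1 j; last first.
    have ie : i = j.-1 by lia.
    have e0 : side (p 0) (p j.+1) = side (p 0) (p i) by apply: nM; rewrite ?out //; lia.
    have e1 : side (p i.-1) (p j.+1) = side (p i.-1) (p i).
      by apply: nM; rewrite ?out //; lia.
    have /negP[] := c3 0 i ltac:(lia) ltac:(lia).
    by rewrite -e0 -e1; apply/eqP; apply: c2; lia.
  pose l := if i == 0 then 1 else 0.
  have [lj li] : l.+1 < j /\ l != i by rewrite /l; case: eqP => ?; split; lia.
  have e0 : side (p l) (p j.+1) = side (p l) (p j) by apply: nM; rewrite ?out //; lia.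
  have e1 : side (p j.-1) (p j.+1) = side (p j.-1) (p j).
    by apply: nM; rewrite ?out //; lia.
  have /negP[] := c3 l j lj ltac:(lia).
  by rewrite -e0 -e1; apply/eqP; apply: c2; lia.
have cm : #|chain_set p m| = m by apply: card_chain_set.
(* As [j <= 2], only the pin with index [1 - i] can be missing. *)
rewrite -{1}cm; apply: (@leq_trans #|p (1 - i) |: M|); last first.
  by rewrite cardsU1; lia.
apply/subset_leq_card/subsetP=> _ /imsetP[[l lm] _ ->] /=; rewrite !inE.
have [->|li] := eqVneq l i; first by rewrite iM orbT.
have [jl|lj] := leqP j l; first by rewrite (up i j l) ?orbT.
have -> : l = 1 - i by lia.
by rewrite eqxx.
Qed.

Lemma chain_simple p m : 4 < m -> chain p m ->
  exists2 S : {set T}, S \subset chain_set p m & simple X Y S /\ m <= #|S| + 2.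
Proof.
move=> m5 cp; have cm := card_chain_set cp.
have [||S SS [sS cS]] := @simple_core _ X Y injX injY (chain_set p m) (p m.-1).
- by rewrite cm.
- by move=> M mM M2; rewrite cm; apply: chain_module.
by exists S => //; rewrite -{1}cm.
Qed.

Lemma chain_good p m k : 2 < k -> 2 * (k + 2) <= m -> chain p m -> good X Y k.
Proof.
(* The two extra pins in each half make up for the points that [chain_simple] may delete. *)
move=> k3 km cp; set h := k + 2.
have c1 : chain p h by apply: chain_trunc cp; lia.
have c2 : chain (fun i => p (h + i)) h.
  by apply: chain_shift; apply: chain_trunc cp; lia.
have [|S1 SS1 [sS1 k1]] := chain_simple _ c1; first lia.
have [|S2 SS2 [sS2 k2]] := chain_simple _ c2; first lia.
exists S1, S2; split; [split=> //; lia|split=> //; lia|].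
rewrite (_ : S1 :&: S2 = set0) ?cards0 //.
apply/setP=> z; rewrite !inE; apply/negP=> /andP[/(subsetP SS1) z1 /(subsetP SS2)].
case/imsetP: z1 => i _ -> /imsetP[j _] /eqP; case: cp => d _ _.
by apply/negP; apply: d; have := ltn_ord i; have := ltn_ord j; lia.
Qed.

(** Entering only at step [t + 2], the point [z] does not cut level [t], which it therefore sees
    uniformly, but it does cut level [t + 1]; one of the two points it separates there differs from
    [a]. *)
Lemma level_separator t a b z :
  z \in level X Y t.+2 a b -> z \notin level X Y t.+1 a b ->
  exists u, [/\ u \in level X Y t.+1 a b, side u z != side a z
    & {in level X Y t a b, forall w, side w z = side a z}].
Proof.
rewrite /level iterS -/(level X Y t.+1 a b) => zl zn.
have cz : cut X Y z (level X Y t.+1 a b).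
  by move: zl; rewrite in_setU (negbTE zn) inE.
have ncz : ~~ cut X Y z (level X Y t a b).
  by apply: contraNN zn => h; rewrite /level iterS in_setU inE h orbT.
have zn' : z \notin level X Y t a b.
  by apply: contraNN zn; apply/subsetP/level_sub.
have [u ul ua] : exists2 u, u \in level X Y t.+1 a b & side u z != side a z.
  have [x [y [xl yl xy]]] := side_cut cz.
  have [e|] := eqVneq (side x z) (side a z); last by exists x.
  by exists y; rewrite // -e eq_sym.
exists u; split=> // w wl; apply/eqP; apply: contraNT ncz.
by apply: cut_side; rewrite ?level0.
Qed.

(** The chain is traced back from [z]. Its predecessor [u] is the separator, which entered exactly
    one step earlier, and the pins before [u] lie in a level that [z] does not cut. *)
Lemma level_chain t a b z : a != b ->
  z \in level X Y t.+1 a b -> z \notin level X Y t a b ->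
  exists p, [/\ p t.+2 = z, forall i, i < t.+2 -> p i \in level X Y t a b
              & chain p t.+3].
Proof.
move=> ab; elim: t z => [|t IH] z.
  rewrite !inE => /orP[->//|cz] /norP[za zb].
  pose p i := if i is i'.+1 then if i' is 0 then b else z else a.
  exists p; split=> //; first by case=> [|[|]]; rewrite // !inE eqxx ?orbT.
  split.
  - by case=> [|[|i]] [|[|[|j]]] //= _ _; rewrite eq_sym.
  - by case=> [|[|i]] [|[|i']] [|[|[|j]]].
  case=> [|[|i]] [|[|[|j]]] //= _ _; apply: contraTneq cz => e.
  apply/negP=> /side_cut[x [y []]]; rewrite !inE.
  by move=> /orP[]/eqP-> /orP[]/eqP->; rewrite ?eqxx // e eqxx.
move=> zl zn; have [u [ul ua nsep]] := level_separator zl zn.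
have un : u \notin level X Y t a b.
  by apply: contraNN ua => ul'; rewrite nsep.
have [p [pu pl [c1 c2 c3]]] := IH u ul un.
have pl' i : i < t.+3 -> p i \in level X Y t.+1 a b.
  rewrite ltnS leq_eqVlt => /predU1P[->|h]; first by rewrite pu.
  by apply: (subsetP (level_sub X Y a b (leqnSn t))); apply: pl.
pose q i := if i == t.+3 then z else p i.
have qz : q t.+3 = z by rewrite /q eqxx.
have qp i : i < t.+3 -> q i = p i by move=> it; rewrite /q ltn_eqF.
have tr2 i j : i.+1 < j -> j < t.+3 -> i < t.+3.
  by move=> h1 h2; apply: ltn_trans (ltnW h1) h2.
exists q; split=> // [i it|]; first by rewrite qp ?pl'.
split=> [i j ij|i i' j ij ij'|i j ij]; rewrite ltnS leq_eqVlt => /predU1P[je|jt];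
  rewrite ?je in ij *.
- by rewrite qz qp //; apply: contraNneq zn => <-; apply: pl'.
- by rewrite !qp ?c1 // (ltn_trans ij).
- rewrite je in ij'; rewrite qz !qp ?(ltnW ij) ?(ltnW ij') //.
  by rewrite !nsep ?pl.
- by rewrite !qp ?(tr2 _ _ ij) ?(tr2 _ _ ij') //; apply: c2.
- rewrite qz !qp ?(ltnW ij) // pu nsep ?pl //.
  by rewrite eq_sym.
- rewrite !qp ?(tr2 _ _ ij) ?c3 //.
  exact: leq_ltn_trans (leq_pred j) jt.
Qed.

(** In a simple set growth stops only at the whole set. If level [K] is smaller, a new point follows
    it, and this point ends a pin sequence of [K + 3] points. *)
Lemma long_level_good K k a b : simple X Y setT -> a != b -> 2 < k ->
  2 * (k + 2) <= K.+3 -> level X Y K a b != setT -> good X Y k.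
Proof.
move=> sT ab k3 kK nT.
have [|z z1 z0] := simple_setT_grow sT _ nT.
  by apply/card_gt1P; exists a, b; rewrite !level0.
have [p [_ _ cp]] := level_chain ab z1 z0; exact: chain_good cp.
Qed.

End Chains.

(** * Alternations *)

(* [lia] is slow when memberships and quantified hypotheses are in the context. *)
Ltac order_lia :=
  repeat match goal with
  | H : ?P |- _ =>
    lazymatch type of P with
    | Prop =>
      lazymatch P with
      | is_true (@Order.lt _ _ _ _) => fail
      | is_true (@Order.le _ _ _ _) => fail
      | is_true (_ && _) => fail
      | _ => clear H
      end
    | _ => fail
    end
  end; lia.

Lemma pairwise_cases (A : eqType) (r : rel A) s a b :
  pairwise r s -> a \in s -> b \in s -> [\/ a = b, r a b | r b a].
Proof.
elim: s => //= c s IH /andP[/allP cs ps]; rewrite !inE.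
case/predU1P=> [->|as_] /predU1P[->|bs].
- by constructor 1.
- by constructor 2; apply: cs.
- by constructor 3; apply: cs.
- exact: IH.
Qed.

Section Alternations.

Variable T : finType.
Implicit Types (X Y : T -> int) (S M : {set T}) (s : seq (T * T)) (w l : T * T).

Definition pts s : {set T} := [set z | (z \in unzip1 s) || (z \in unzip2 s)].

Lemma mem_pts1 s w : w \in s -> w.1 \in pts s.
Proof. by move=> ws; rewrite inE map_f. Qed.

Lemma mem_pts2 s w : w \in s -> w.2 \in pts s.
Proof. by move=> ws; rewrite inE [_ \in unzip2 s]map_f ?orbT. Qed.

Lemma ptsP s z : z \in pts s -> exists2 w : T * T, w \in s & z = w.1 \/ z = w.2.
Proof. by rewrite inE => /orP[]/mapP[w ws ->]; exists w; auto. Qed.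

(* In a pair [(u, b)] of the list, [u] is the upper and [b] the lower point. *)
Definition alternation X Y s : Prop :=
  [/\ {in s, forall w, (X w.1 < X w.2)%R},
      pairwise (fun w w' => (X w.2 < X w'.1)%R) s
    & {in s &, forall w w', (Y w.2 < Y w'.1)%R}].

Definition parallel X Y s : Prop := alternation X Y s /\
  pairwise (fun w w' => (Y w.1 < Y w'.1)%R && (Y w.2 < Y w'.2)%R) s.

(* Opens to the left: the outermost pair comes first. *)
Definition wedge X Y s : Prop := alternation X Y s /\
  pairwise (fun w w' => (Y w'.1 < Y w.1)%R && (Y w.2 < Y w'.2)%R) s.

Lemma alternation_sub X Y s s' :
  subseq s' s -> alternation X Y s -> alternation X Y s'.
Proof.
move=> ss [a1 a2 a3]; have m := mem_subseq ss; split.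
- by move=> w /m; apply: a1.
- exact: subseq_pairwise a2.
- by move=> w w' /m ws /m ws'; apply: a3.
Qed.

Lemma parallel_sub X Y s s' : subseq s' s -> parallel X Y s -> parallel X Y s'.
Proof.
move=> ss [a p]; split; [exact: alternation_sub a|exact: subseq_pairwise p].
Qed.

Lemma wedge_sub X Y s s' : subseq s' s -> wedge X Y s -> wedge X Y s'.
Proof.
move=> ss [a p]; split; [exact: alternation_sub a|exact: subseq_pairwise p].
Qed.

(** * Simplicity of parallel alternations and of extended wedges *)

Section Simple.

Variables X Y : T -> int.

Lemma module_X S M a b c : module X Y S M -> a \in M -> b \in M -> c \in S ->
  (X a < X c < X b)%R -> c \in M.
Proof. by move=> [_ cM] aM bM cS h; apply: cM => //; apply: cutX h. Qed.

Lemma module_Y S M a b c : module X Y S M -> a \in M -> b \in M -> c \in S ->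
  (Y a < Y c < Y b)%R -> c \in M.
Proof. by move=> [_ cM] aM bM cS h; apply: cM => //; apply: cutY h. Qed.

(** Between two upper points lies, in abscissa, the lower partner of the left one; between two lower
    points, the upper partner of the right one. *)
Lemma alternation_module s S M x y :
  alternation X Y s -> module X Y S M -> pts s \subset S ->
  x \in M -> y \in M -> x \in pts s -> y \in pts s -> x != y ->
  exists w w', [/\ w \in s, w' \in s, w.1 \in M & w'.2 \in M].
Proof.
move=> [a1 a2 _] mM /subsetP sS xM yM /ptsP[w ws xw] /ptsP[w' ws' yw'] xy.
case: xw yw' => xw [yw'|yw']; subst.
- case: (pairwise_cases a2 ws ws') => [e|h|h]; first by rewrite e eqxx in xy.
    exists w, w; split=> //; apply: (module_X mM xM yM); first exact/sS/mem_pts2.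
    by rewrite a1.
  exists w, w'; split=> //; apply: (module_X mM yM xM); first exact/sS/mem_pts2.
  by rewrite a1.
- by exists w, w'.
- by exists w', w.
case: (pairwise_cases a2 ws ws') => [e|h|h]; first by rewrite e eqxx in xy.
  exists w', w'; split=> //; apply: (module_X mM xM yM); first exact/sS/mem_pts1.
  by rewrite h a1.
exists w, w'; split=> //; apply: (module_X mM yM xM); first exact/sS/mem_pts1.
by rewrite h a1.
Qed.

(** [M] contains an upper and a lower point. Their ordinates enclose all upper points to the left of
    the first and all lower points to the right of the second; the others have abscissas between
    points already found. *)
Lemma parallel_simple s : parallel X Y s -> simple X Y (pts s).
Proof.
move=> [al pw] M mM /card_gt1P[x [y [xM yM xy]]].
have [a1 a2 a3] := al; have /subsetP MS := mM.1.
have := alternation_module al mM (subxx _) xM yM (MS _ xM) (MS _ yM) xy.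
case=> ui [bj [uis bjs uiM bjM]].
have tri w w' : w \in s -> w' \in s ->
  [\/ w = w', [/\ (X w.2 < X w'.1)%R, (Y w.1 < Y w'.1)%R & (Y w.2 < Y w'.2)%R]
    | [/\ (X w'.2 < X w.1)%R, (Y w'.1 < Y w.1)%R & (Y w'.2 < Y w.2)%R]].
  have := pairwise_relI (fun w w' => (X w.2 < X w'.1)%R)
    (fun w w' => (Y w.1 < Y w'.1)%R && (Y w.2 < Y w'.2)%R) s.
  rewrite a2 pw => /pairwise_cases c ws ws'.
  by case: (c _ _ ws ws') => [->|/= /and3P[]|/= /and3P[]];
    [constructor 1|constructor 2|constructor 3].
have u_le l : l \in s -> (Y l.1 <= Y ui.1)%R -> l.1 \in M.
  move=> ls le; case: (tri _ _ ls uis) => [->//|[_ h _]|[_ h _]]; last order_lia.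
  by apply: (module_Y mM bjM uiM) (mem_pts1 ls) _; rewrite a3 // h.
have b_ge l : l \in s -> (Y bj.2 <= Y l.2)%R -> l.2 \in M.
  move=> ls le; case: (tri _ _ ls bjs) => [->//|[_ _ h]|[_ _ h]]; first order_lia.
  by apply: (module_Y mM bjM uiM) (mem_pts2 ls) _; rewrite a3 // h.
apply/eqP; rewrite eqEsubset mM.1 /=; apply/subsetP=> z /ptsP[l ls].
have sX w : w \in s -> (X w.1 < X w.2)%R by exact: a1.
have lX := sX _ ls; have uX := sX _ uis; have bX := sX _ bjs.
case=> ->.
  case: (tri _ _ ls uis) => [->//|[h1 h2 h3]|[h1 h2 h3]]; first by apply: (u_le _ ls); order_lia.
  case: (tri _ _ ls bjs) => [e|[g1 g2 g3]|[g1 g2 g3]].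
  - by subst l; apply: (module_X mM uiM bjM (mem_pts1 ls)); order_lia.
  - by apply: (module_X mM uiM bjM (mem_pts1 ls)); order_lia.
  - have bl : l.2 \in M by apply: (b_ge _ ls); order_lia.
    by apply: (module_X mM uiM bl (mem_pts1 ls)); order_lia.
case: (tri _ _ ls bjs) => [->//|[g1 g2 g3]|[g1 g2 g3]]; last by apply: (b_ge _ ls); order_lia.
case: (tri _ _ ls uis) => [e|[h1 h2 h3]|[h1 h2 h3]].
- by subst l; apply: (module_X mM uiM bjM (mem_pts2 ls)); order_lia.
- have ul : l.1 \in M by apply: (u_le _ ls); order_lia.
  by apply: (module_X mM ul bjM (mem_pts2 ls)); order_lia.
- by apply: (module_X mM uiM bjM (mem_pts2 ls)); order_lia.
Qed.

Lemma wedge_head w0 s w : wedge X Y (w0 :: s) -> w \in w0 :: s ->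
  w = w0 \/ [/\ (X w0.2 < X w.1)%R, (Y w.1 < Y w0.1)%R & (Y w0.2 < Y w.2)%R].
Proof.
move=> [[_ /= /andP[/allP h1 _] _] /= /andP[/allP h2 _]].
by rewrite inE => /predU1P[->|ws]; [left|right; have /andP[] := h2 _ ws; split=> //; apply: h1].
Qed.

(** As [z] separates the rows, [M] contains [z] and a point of the wedge. Abscissas then give the
    outermost upper point, ordinates the next upper point, abscissas the outermost lower point, and
    the ordinates of the outermost pair enclose the rest. *)
Lemma wedge_left_simple s z : wedge X Y s -> 1 < size s ->
  {in s, forall w, (X z < X w.1)%R && (Y w.2 < Y z < Y w.1)%R} ->
  simple X Y (z |: pts s).
Proof.
case: s => [|w0 [|w1 s]] // wd _ hz M mM /card_gt1P[x [y [xM yM xy]]].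
set s0 := [:: w0, w1 & s] in wd hz mM *.
have [a1 a2 a3] := wd.1; have /subsetP MS := mM.1.
have w0s : w0 \in s0 by rewrite mem_head.
have w1s : w1 \in s0 by rewrite !inE eqxx orbT.
have p1 w : w \in s0 -> w.1 \in z |: pts s0 by move=> ?; rewrite inE mem_pts1 ?orbT.
have p2 w : w \in s0 -> w.2 \in z |: pts s0 by move=> ?; rewrite inE mem_pts2 ?orbT.
have [zM [e eM es]] : z \in M /\ exists2 e, e \in M & e \in pts s0.
  have [xz|xz] := eqVneq x z.
    rewrite -xz xM; split=> //; exists y => //.
    by have := MS _ yM; rewrite !in_setU1 -xz eq_sym (negbTE xy).
  have xs : x \in pts s0 by have := MS _ xM; rewrite in_setU1 (negbTE xz).
  split; last by exists x.
  have [yz|yz] := eqVneq y z; first by rewrite -yz.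
  have ys : y \in pts s0 by have := MS _ yM; rewrite in_setU1 (negbTE yz).
  have [w [w' [ws ws' wM wM']]] :=
    alternation_module wd.1 mM (subsetUr _ _) xM yM xs ys xy.
  apply: (module_Y mM wM' wM); first by rewrite setU11.
  by have /and3P[_ _ ->] := hz _ ws; have /and3P[_ -> _] := hz _ ws'.
have X0 := a1 _ w0s; have X1 := a1 _ w1s.
have /and3P[z0 _ zu0] := hz _ w0s; have /and3P[z1 zb1 zu1] := hz _ w1s.
have [//|[X01 Y01 Y01']] := wedge_head wd w1s.
  by move=> e1; move: a2; rewrite /= e1 => /andP[/andP[]]; order_lia.
have w0M : w0.1 \in M.
  have [w ws [ew|ew]] := ptsP es; have Xw := a1 _ ws;
    case: (wedge_head wd ws) => [w0e|[g _ _]]; subst.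
  - by [].
  - by apply: (module_X mM zM eM (p1 _ w0s)); order_lia.
  - by apply: (module_X mM zM eM (p1 _ w0s)); order_lia.
  - by apply: (module_X mM zM eM (p1 _ w0s)); order_lia.
have u1M : w1.1 \in M by apply: (module_Y mM zM w0M (p1 _ w1s)); order_lia.
have b0M : w0.2 \in M by apply: (module_X mM w0M u1M (p2 _ w0s)); order_lia.
apply/eqP; rewrite eqEsubset mM.1 /=; apply/subsetP=> c; rewrite in_setU1.
case/predU1P=> [->//|/ptsP[w ws cw]].
case: (wedge_head wd ws) => [we|[g1 g2 g3]]; first by case: cw => ->; rewrite we.
have := a3 _ _ w0s ws; have := a3 _ _ ws w0s; have := a3 _ _ ws ws.
case: cw => -> *.
  by apply: (module_Y mM b0M w0M (p1 _ ws)); order_lia.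
by apply: (module_Y mM b0M w0M (p2 _ ws)); order_lia.
Qed.

(** Any two points bring in [x], which separates the rows; then [z], whose abscissa is between the
    wedge and [x]; then the outermost upper point, whose ordinate is between [x] and [z]. The
    abscissas from there to [x] enclose everything. *)
Lemma wedge_right_simple s z x : wedge X Y s -> 0 < size s ->
  (X z < X x)%R ->
  {in s, forall w, [/\ (X w.2 < X z)%R, (Y w.1 < Y z)%R & (Y w.2 < Y x < Y w.1)%R]} ->
  simple X Y ([set z; x] :|: pts s).
Proof.
case: s => [|w0 s] // wd _ zx hz M mM /card_gt1P[c [d [cM dM cd]]].
set s0 := w0 :: s in wd hz mM *.
have [a1 a2 a3] := wd.1; have /subsetP MS := mM.1.
have w0s : w0 \in s0 by rewrite mem_head.
have sub : pts s0 \subset [set z; x] :|: pts s0 by exact: subsetUr.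
have p1 w : w \in s0 -> w.1 \in [set z; x] :|: pts s0.
  by move=> ?; rewrite inE mem_pts1 ?orbT.
have p2 w : w \in s0 -> w.2 \in [set z; x] :|: pts s0.
  by move=> ?; rewrite inE mem_pts2 ?orbT.
have zS : z \in [set z; x] :|: pts s0 by rewrite !inE eqxx.
have xS : x \in [set z; x] :|: pts s0 by rewrite !inE eqxx orbT.
have mid w w' : w \in s0 -> w' \in s0 -> w.1 \in M -> w'.2 \in M -> x \in M.
  move=> ws ws' wM wM'; apply: (module_Y mM wM' wM xS).
  by have [_ _ /andP[_ ->]] := hz _ ws; have [_ _ /andP[->]] := hz _ ws'.
have withz e : e \in pts s0 -> e \in M -> z \in M -> x \in M.
  case/ptsP=> w ws [->|->] eM zM; have [h1 h2 /andP[h3 h4]] := hz _ ws.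
    apply: (mid w w) => //; apply: (module_X mM eM zM (p2 _ ws)).
    by rewrite a1.
  by apply: (module_Y mM eM zM xS); rewrite h3 (Order.POrderTheory.lt_trans h4).
have cases e : e \in M -> [\/ e = z, e = x | e \in pts s0].
  by move/MS; rewrite in_setU in_set2 => /orP[/orP[]/eqP|];
    [constructor 1|constructor 2|constructor 3].
have xM : x \in M.
  case: (cases _ cM) (cases _ dM) => [ez|<-//|cs] [dz|<-//|ds]; subst.
  - by rewrite eqxx in cd.
  - exact: (withz d).
  - exact: (withz c).
  have [w [w' [ws ws' wM wM']]] := alternation_module wd.1 mM sub cM dM cs ds cd.
  exact: mid ws ws' wM wM'.
have [e eM ex] : exists2 e, e \in M & e != x.
  by have [<-|] := eqVneq c x; [exists d; rewrite // eq_sym|exists c].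
have zM : z \in M.
  case: (cases _ eM) ex => [<-//|->|/ptsP[w ws we]]; first by rewrite eqxx.
  move=> _; have [h _ _] := hz _ ws; have h' := a1 _ ws.
  by apply: (module_X mM eM xM zS); case: we => ->; order_lia.
have [g1 g2 /andP[g3 g4]] := hz _ w0s; have X0 := a1 _ w0s.
have w0M : w0.1 \in M by apply: (module_Y mM xM zM (p1 _ w0s)); order_lia.
apply/eqP; rewrite eqEsubset mM.1 /=; apply/subsetP=> f.
rewrite in_setU in_set2 => /orP[/orP[]/eqP->//|/ptsP[w ws fw]].
have [k1 _ _] := hz _ ws; have X1 := a1 _ ws.
case: (wedge_head wd ws) => [we|[l1 _ _]].
  subst w; case: fw => -> //.
  by apply: (module_X mM w0M xM (p2 _ w0s)); order_lia.
case: fw => ->; first by apply: (module_X mM w0M xM (p1 _ ws)); order_lia.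
by apply: (module_X mM w0M xM (p2 _ ws)); order_lia.
Qed.

End Simple.
End Alternations.

Lemma sub_in_pairwise_mem (A : eqType) (r r' : rel A) s :
  {in s &, forall a b, r a b -> r' a b} -> pairwise r s -> pairwise r' s.
Proof. by move=> h; apply: (sub_in_pairwise h); apply/allP. Qed.

Lemma mem_pairmap (A B : eqType) (r : rel A) (f : A -> A -> B) a s v :
  pairwise r (a :: s) -> v \in pairmap f a s ->
  exists c d, [/\ v = f c d, r c d, c = a \/ r a c & c \in a :: s /\ d \in a :: s].
Proof.
elim: s a => //= b s IH a /andP[/andP[ab as_] bs].
rewrite inE => /predU1P[->|/(IH _ bs)[c [d [-> cd bc [cs ds]]]]].
  by exists a, b; rewrite !inE !eqxx orbT; split; auto.
exists c, d; split=> //; last by rewrite in_cons cs in_cons ds !orbT.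
by right; move: cs; rewrite inE => /predU1P[->//|cs]; apply: (allP as_).
Qed.

Lemma pairwise_pairmap (A B : eqType) (r : rel A) (R : rel B) f a s :
  (forall a b c d, r a b -> r c d -> c = b \/ r b c -> R (f a b) (f c d)) ->
  pairwise r (a :: s) -> pairwise R (pairmap f a s).
Proof.
move=> h; elim: s a => //= b s IH a /andP[/andP[ab as_] bs].
rewrite IH // andbT; apply/allP=> v /(mem_pairmap bs)[c [d [-> cd bc _]]].
exact: h.
Qed.

(** * Two simple halves of an alternation *)

Section Halves.

Variable T : finType.
Implicit Types (X Y : T -> int) (S M : {set T}) (s : seq (T * T)) (w l : T * T).

Lemma alternation_uniq X Y s : alternation X Y s -> uniq (unzip1 s).
Proof.
move=> [a1 a2 _]; rewrite uniq_pairwise pairwise_map.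
apply: sub_in_pairwise_mem a2 => w w' ws ws' h /=.
by apply: contraTneq (a1 _ ws) => e; move: h; rewrite e; order_lia.
Qed.

Lemma card_pts X Y s : alternation X Y s -> size s <= #|pts s|.
Proof.
move/alternation_uniq=> us; rewrite -(size_map fst) cardE; apply: uniq_leq_size => //.
by move=> z /mapP[w ws ->]; rewrite mem_enum mem_pts1.
Qed.

Lemma pts_disjoint X Y s1 s2 : alternation X Y (s1 ++ s2) -> pts s1 :&: pts s2 = set0.
Proof.
move=> [a1]; rewrite pairwise_cat => /and3P[/allrelP a2 _ _] _.
apply/setP=> z; rewrite in_setI in_set0; apply/negP=> /andP[].
move=> /ptsP[w ws zw] /ptsP[w' ws' zw']; have h := a2 _ _ ws ws'.
have h1 : (X w.1 < X w.2)%R by apply: a1; rewrite mem_cat ws.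
have h2 : (X w'.1 < X w'.2)%R by apply: a1; rewrite mem_cat ws' orbT.
have : (X z <= X w.2)%R by case: zw => ->; order_lia.
have : (X w'.1 <= X z)%R by case: zw' => ->; order_lia.
by order_lia.
Qed.

(** The points of [take k s] and [drop k s] are disjoint, so after adding [E] to both, only [E] is
    shared. *)
Lemma good_halves X Y k s (E : {set T}) :
  alternation X Y s -> #|E| <= 2 -> 2 * k <= size s ->
  (forall s', subseq s' s -> k <= size s' -> simple X Y (E :|: pts s')) ->
  good X Y k.
Proof.
move=> al E2 ks h; have sz s' : subseq s' s -> size s' <= #|E :|: pts s'|.
  move=> ss; apply: leq_trans (subset_leq_card (subsetUr _ _)).
  exact/card_pts/(alternation_sub ss al).
have t1 : k <= size (take k s) by rewrite size_take; case: ltnP; lia.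
have t2 : k <= size (drop k s) by rewrite size_drop; lia.
have u1 := take_subseq s k; have u2 := drop_subseq s k.
exists (E :|: pts (take k s)), (E :|: pts (drop k s)); split.
- by split; [apply: h|apply: leq_trans (sz _ u1)].
- by split; [apply: h|apply: leq_trans (sz _ u2)].
- by rewrite -setUIr (@pts_disjoint X Y) ?setU0 ?cat_take_drop.
Qed.

Lemma parallel_good X Y k s : parallel X Y s -> 2 * k <= size s -> good X Y k.
Proof.
move=> ps ks; apply: (good_halves (E := set0) ps.1 _ ks); first by rewrite cards0.
by move=> s' ss _; rewrite set0U; apply/parallel_simple/(parallel_sub ss).
Qed.

Lemma wedge_left_good X Y k s z : 1 < k -> wedge X Y s -> 2 * k <= size s ->
  {in s, forall w, (X z < X w.1)%R && (Y w.2 < Y z < Y w.1)%R} -> good X Y k.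
Proof.
move=> k1 ws ks hz; apply: (good_halves (E := [set z]) ws.1 _ ks).
  by rewrite cards1.
move=> s' ss ks'; apply: wedge_left_simple; first exact: wedge_sub ws.
  exact: leq_trans k1 ks'.
by move=> w /(mem_subseq ss); apply: hz.
Qed.

Lemma wedge_right_good X Y k s z x : 1 < k -> wedge X Y s -> 2 * k <= size s ->
  (X z < X x)%R ->
  {in s, forall w, [/\ (X w.2 < X z)%R, (Y w.1 < Y z)%R & (Y w.2 < Y x < Y w.1)%R]} ->
  good X Y k.
Proof.
move=> k1 ws ks zx hz; apply: (good_halves (E := [set z; x]) ws.1 _ ks).
  by rewrite cards2; case: eqP.
move=> s' ss ks'; apply: wedge_right_simple zx _; first exact: wedge_sub ws.
  exact: leq_trans (ltnW k1) ks'.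
by move=> w /(mem_subseq ss); apply: hz.
Qed.

(* Pairing each lower point with the next upper point, and turning the picture
   upside down, makes the list start with a lower point. *)
Definition shift_pairs (w0 : T * T) s : seq (T * T) :=
  pairmap (fun w w' => (w.2, w'.1)) w0 s.

Lemma alternation_pairwise X Y s (r : rel (T * T)) :
  alternation X Y s -> pairwise r s ->
  pairwise (fun w w' => [&& r w w', (X w.1 < X w.2)%R, (X w.2 < X w'.1)%R &
                            (X w'.1 < X w'.2)%R]) s.
Proof.
move=> [a1 a2 a3] pr; have := pairwise_relI r (fun w w' => (X w.2 < X w'.1)%R) s.
rewrite a2 pr; apply: sub_in_pairwise_mem => w w' ws ws' /= /andP[-> ->] /=.
by rewrite !a1.
Qed.

Lemma shift_pairs_alternation X Y w0 s : alternation X Y (w0 :: s) ->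
  alternation X (fun t => - Y t)%R (shift_pairs w0 s).
Proof.
move=> al; have [a1 a2 a3] := al.
have pr := alternation_pairwise al a2; split.
- by move=> v /(mem_pairmap pr)[c [d [-> /and4P[h _ _ _] _ _]]].
- apply: (pairwise_pairmap _ pr) => a b c d /and4P[h1 h2 h3 h4] /and4P[g1 g2 g3 g4] /=.
  by case=> [e|/and4P[]]; first subst; order_lia.
- move=> v v' /(mem_pairmap pr)[c [d [-> _ _ [cs ds]]]].
  move=> /(mem_pairmap pr)[c' [d' [-> _ _ [cs' ds']]]] /=.
  by have := a3 _ _ cs' ds; order_lia.
Qed.

Lemma shift_pairs_parallel X Y w0 s : alternation X Y (w0 :: s) ->
  pairwise (fun w w' => (Y w'.1 < Y w.1)%R && (Y w'.2 < Y w.2)%R) (w0 :: s) ->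
  parallel X (fun t => - Y t)%R (shift_pairs w0 s).
Proof.
move=> al pr; split; first exact: shift_pairs_alternation.
apply: (pairwise_pairmap _ pr) => a b c d /andP[h1 h2] /andP[g1 g2] /=.
by case=> [e|/andP[]]; first subst; order_lia.
Qed.

Lemma shift_pairs_wedge X Y w0 s : wedge X Y (w0 :: s) ->
  wedge X (fun t => - Y t)%R (shift_pairs w0 s).
Proof.
move=> [al pr]; split; first exact: shift_pairs_alternation.
apply: (pairwise_pairmap _ pr) => a b c d /andP[h1 h2] /andP[g1 g2] /=.
by case=> [e|/andP[]]; first subst; order_lia.
Qed.

(** The inside of a wedge behind the pair [w], unbounded to the right: it contains the later pairs
    but neither point of [w]. *)
Definition box X Y w : {set T} :=
  [set z | (X w.2 < X z)%R && (Y w.2 < Y z < Y w.1)%R].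

(* A point cutting the inner box but outside the outer one jumps over all the
   intermediate pairs. *)
Lemma wedge_jump X Y k w0 s w (A : {set T}) z : 1 < k ->
  wedge X Y (w0 :: rcons s w) -> (2 * k).+1 <= size s -> A \subset box X Y w ->
  cut X Y z A -> z \notin box X Y w0 -> good X Y k.
Proof.
move=> k1 wd ks /subsetP AB cz zn; have [a1 a2 a3] := wd.1.
have ss : subseq s (w0 :: rcons s w).
  by apply: subseq_trans (subseq_rcons _ _) (subseq_cons _ _).
have w0s : w0 \in w0 :: rcons s w by rewrite mem_head.
have wws : w \in w0 :: rcons s w by rewrite inE mem_rcons mem_head orbT.
have wds := wedge_sub ss wd.
have outer l : l \in s ->
  [/\ (X w0.2 < X l.1)%R, (Y l.1 < Y w0.1)%R & (Y w0.2 < Y l.2)%R].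
  move=> ls; move: a2 wd.2; rewrite 2!pairwise_cons !all_rcons.
  move=> /andP[/andP[_ /allP h1] _] /andP[/andP[_ /allP h2] _].
  by split; [exact: h1|have /andP[] := h2 _ ls|have /andP[] := h2 _ ls].
have inner l : l \in s ->
  [/\ (X l.2 < X w.1)%R, (Y w.1 < Y l.1)%R & (Y l.2 < Y w.2)%R].
  move=> ls; move: a2 wd.2; rewrite 2!pairwise_cons 2!pairwise_rcons.
  move=> /and3P[_ /allP h1 _] /and3P[_ /allP h2 _].
  by split; [exact: h1|have /andP[] := h2 _ ls|have /andP[] := h2 _ ls].
have ls12 l : l \in s -> (X l.1 < X l.2)%R.
  by move=> ls; apply: a1; apply: (mem_subseq ss).
have w12 := a1 _ wws; have w012 := a1 _ w0s.
have wY := a3 _ _ wws wws; have w0Y := a3 _ _ w0s w0s.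
have [l0 l0s] : exists l, l \in s by case: (s) ks => // l0 ? _; exists l0; rewrite mem_head.
have [o1 o2 o3] := outer _ l0s; have [i1 i2 i3] := inner _ l0s; have m := ls12 _ l0s.
have /cutP[e [f [/AB eA /AB fA h]]] := cz.
move: eA fA; rewrite !inE => /and3P[e1 e2 e3] /and3P[f1 f2 f3].
(* A cut by ordinate puts [z] between the rows, hence to the left of all intermediate pairs. *)
case/orP: h => h; last first.
  apply: (@wedge_left_good X Y k s z) => //; first lia.
  move=> l ls; have [p1 p2 p3] := outer _ ls; have [q1 q2 q3] := inner _ ls.
  by move: zn; rewrite inE; order_lia.
(* A cut by abscissa puts [z] to the right of the intermediate pairs, above or below them. The point
   [f], further right and between the rows, completes the configuration. *)
have [zu|zu] := Order.TotalTheory.leP (Y w0.1) (Y z).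
  apply: (@wedge_right_good X Y k s z f) => //; [lia|order_lia|].
  move=> l ls; have [p1 p2 p3] := outer _ ls; have [q1 q2 q3] := inner _ ls.
  by split; order_lia.
have zb : (Y z <= Y w0.2)%R by move: zn; rewrite inE; order_lia.
(* If [z] is below, the picture is turned upside down. Pairing anew costs one pair, which is the
   extra one in the bound on [size s]. *)
apply: (good_transfer (fun t A => cut_oppr X Y t A)).
case: s => [//|l1 s'] in ks wd ss wds outer inner ls12 l0s a1 a2 a3 w0s wws *.
have wd' := shift_pairs_wedge wds.
apply: (wedge_right_good k1 wd' _ (z := z) (x := f)).
- by rewrite size_pairmap.
- by order_lia.
have [b1 b2 _] := wds.1.
move=> v /(mem_pairmap (alternation_pairwise wds.1 b2))[c [d [-> _ _ [cs ds]]]] /=.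
have [p1 p2 p3] := outer _ cs; have [q1 q2 q3] := inner _ cs.
have [p1' p2' p3'] := outer _ ds; have [q1' q2' q3'] := inner _ ds.
have := ls12 _ ds; have := ls12 _ cs.
by split; order_lia.
Qed.

End Halves.

Lemma pairwise_rev (A : Type) (r : rel A) s :
  pairwise r (rev s) = pairwise (fun x y => r y x) s.
Proof.
by elim: s => //= a s IH; rewrite rev_cons pairwise_rcons all_rev IH.
Qed.

(** The colour of a pair is read in list order, so [c] need not be symmetric. The head of the list
    splits the tail by colour, and one of the two parts is long enough for induction. *)
Lemma ramsey a b : exists N, forall (A : eqType) (c : rel A) (s : seq A),
  N <= size s ->
  (exists s', [/\ subseq s' s, a <= size s' & pairwise c s']) \/
  (exists s', [/\ subseq s' s, b <= size s' & pairwise (fun x y => ~~ c x y) s']).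
Proof.
elim: a b => [|a IHa] b; first by exists 0 => A c s _; left; exists [::]; rewrite sub0seq.
elim: b => [|b [N2 IHb]]; first by exists 0 => A c s _; right; exists [::]; rewrite sub0seq.
have [N1 IH1] := IHa b.+1.
exists (N1 + N2).+1 => A c [|x s] // sz.
have {}sz : N1 + N2 <= size s by [].
have szc : size (filter (c x) s) + size (filter (predC (c x)) s) = size s.
  by rewrite !size_filter count_predC.
have [l1|l1] := leqP N1 (size (filter (c x) s)).
  have [[s' [ss as' ps]]|[s' [ss as' ps]]] := IH1 _ c _ l1.
    left; exists (x :: s'); split=> //=; first by rewrite eqxx (subseq_trans ss) ?filter_subseq.
    rewrite ps andbT; apply/allP=> y /(mem_subseq ss).
    by rewrite mem_filter => /andP[].
  right; exists s'; split=> //; apply: subseq_trans ss _.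
  exact: subseq_trans (filter_subseq _ _) (subseq_cons _ _).
have l2 : N2 <= size (filter (predC (c x)) s) by lia.
have [[s' [ss as' ps]]|[s' [ss as' ps]]] := IHb _ c _ l2.
  left; exists s'; split=> //; apply: subseq_trans ss _.
  exact: subseq_trans (filter_subseq _ _) (subseq_cons _ _).
right; exists (x :: s'); split=> //=; first by rewrite eqxx (subseq_trans ss) ?filter_subseq.
rewrite ps andbT; apply/allP=> y /(mem_subseq ss).
by rewrite mem_filter => /andP[].
Qed.

(** * Wedges and alternations when few steps reach everything *)

Section ShortLevels.

Variables (T : finType) (k K : nat).
Hypothesis k1 : 1 < k.
Implicit Types (X Y : T -> int) (A : {set T}) (s : seq (T * T)) (w : T * T).

Definition short X Y : Prop := forall a b : T, a != b -> level X Y K a b = setT.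

(** Without a jump, one step of growth leaves the box of a pair only for the box of the pair
    [2 * k + 2] places further out. After [t] steps the set still lies in a box, and a box misses
    its own pair. *)
Lemma wedge_iter X Y t s w A :
  wedge X Y (rcons s w) -> A \subset box X Y w -> t * (2 * k).+2 <= size s ->
  good X Y k \/ iter t (grow X Y) A != setT.
Proof.
elim: t s w A => [|t IH] s w A wd Ab sz.
  right; apply/negP=> /eqP e; have : w.1 \in box X Y w by apply: (subsetP Ab); rewrite [A]e inE.
  rewrite inE; have [a1 _ _] := wd.1; have := a1 w; rewrite mem_rcons mem_head => /(_ isT).
  by order_lia.
(* The last [2 * k + 2] pairs of [s] are the new outer pair [w0] and the [2 * k + 1] pairs that a
   jump has to pass. *)
set n := size s - (2 * k).+2.
have szd : size (drop n s) = (2 * k).+2 by rewrite size_drop /n; lia.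
case ds : (drop n s) szd => [//|w0 s'] [szs].
have se : rcons s w = rcons (take n s) w0 ++ rcons s' w.
  by rewrite -{1}(cat_take_drop n s) ds cat_rcons rcons_cat.
have wd1 : wedge X Y (w0 :: rcons s' w).
  by apply: wedge_sub wd; rewrite se cat_rcons suffix_subseq.
have wd2 : wedge X Y (rcons (take n s) w0).
  by apply: wedge_sub wd; rewrite se prefix_subseq.
have [gb|] := boolP (grow X Y A \subset box X Y w0).
  rewrite iterSr; apply: IH wd2 gb _; rewrite size_take; case: ltnP; lia.
case/subsetPn=> z zg zn; left.
apply: (wedge_jump k1 wd1 _ Ab _ zn); first by rewrite szs.
move: zg; rewrite in_setU inE => /orP[zA|//]; case/negP: zn.
have := subsetP Ab _ zA; rewrite !inE.
have [||[h1 h2 h3]] := wedge_head wd1 (w := w); first by rewrite inE mem_rcons mem_head orbT.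
  by move=> ->.
have [a1 _ _] := wd1.1; have := a1 w; rewrite inE mem_rcons mem_head orbT => /(_ isT).
by order_lia.
Qed.

(** Growth starts from the innermost pair, which lies in the box of the next one; these are the two
    pairs besides the [K] blocks. Had no jump occurred, level [K] would not be everything. *)
Lemma wedge_good X Y s : short X Y -> wedge X Y s ->
  (K * (2 * k).+2).+2 <= size s -> good X Y k.
Proof.
move=> sh wd; case/lastP: s wd => [//|s v]; case/lastP: s => [//|s w] wd.
rewrite !size_rcons !ltnS => sz.
have wv : wedge X Y [:: w; v].
  by apply: wedge_sub wd; rewrite -!cats1 -catA suffix_subseq.
have wd' : wedge X Y (rcons s w) by apply: wedge_sub wd; exact: subseq_rcons.
have [a1 /= a2 a3] := wv.1; have := wv.2; rewrite /= !andbT in a2 *.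
have iw : w \in [:: w; v] by rewrite mem_head.
have iv : v \in [:: w; v] by rewrite !inE eqxx orbT.
have := a1 _ iv; have := a3 _ _ iw iv; have := a3 _ _ iv iw => h1 h2 h3 h4.
have vv : v.1 != v.2 by apply: contraTneq h3 => ->; order_lia.
have vb : [set v.1; v.2] \subset box X Y w.
  by apply/subsetP=> z; rewrite !inE => /orP[]/eqP->; order_lia.
by have [//|] := wedge_iter wd' vb sz; rewrite -/(level X Y K v.1 v.2) sh // eqxx.
Qed.

End ShortLevels.

(** Ramsey's theorem is applied to the upper row and then to the lower row. The four combinations of
    directions are two parallel alternations and two wedges, up to symmetry. *)
Lemma alternation_good k K : 1 < k -> exists N, forall (T : finType) (X Y : T -> int) s,
  injective Y -> short K X Y -> alternation X Y s -> N <= size s -> good X Y k.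
Proof.
move=> k1; pose m := (K * (2 * k).+2).+2 + (2 * k).+1.
have [N2 R2] := ramsey m m; have [N1 R1] := ramsey N2 N2.
exists N1 => T X Y s injY sh al /(R1 _ (fun w w' => Y w.1 < Y w'.1)%R) h.
have {h} [s1 [ss1 sz1 [d1 m1]]] : exists s1, [/\ subseq s1 s, N2 <= size s1 &
    exists d1 : bool, pairwise (fun w w' => if d1 then Y w.1 < Y w'.1 else Y w'.1 < Y w.1)%R s1].
  case: h => -[s1 [ss1 sz1 m1]]; exists s1; split=> //; first by exists true.
  exists false; have [_ a2 _] := alternation_sub ss1 al.
  apply: sub_in_pairwise_mem (alternation_pairwise (alternation_sub ss1 al) m1).
  move=> [u b] [u' b'] /= _ _ /and4P[h1 h2 h3 _].
  have : Y u != Y u' by rewrite (inj_eq injY); apply: contraTneq h3 => <-; order_lia.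
  by move: h1; lia.
have al1 := alternation_sub ss1 al.
have := R2 _ (fun w w' => Y w.2 < Y w'.2)%R s1 sz1 => h.
have {h} [s2 [ss2 sz2 [d2 m2]]] : exists s2, [/\ subseq s2 s1, m <= size s2 &
    exists d2 : bool, pairwise (fun w w' => if d2 then Y w.2 < Y w'.2 else Y w'.2 < Y w.2)%R s2].
  case: h => -[s2 [ss2 sz2 m2]]; exists s2; split=> //; first by exists true.
  exists false; have [_ a2 _] := alternation_sub ss2 al1.
  apply: sub_in_pairwise_mem (alternation_pairwise (alternation_sub ss2 al1) m2).
  move=> [u b] [u' b'] /= _ _ /and4P[h1 _ h3 h4].
  have : Y b != Y b' by rewrite (inj_eq injY); apply: contraTneq h4 => <-; order_lia.
  by move: h1; lia.
have al2 := alternation_sub ss2 al1.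
have {}m1 := subseq_pairwise ss2 m1.
have szk : (2 * k).+1 <= size s2 by apply: leq_trans sz2; apply: leq_addl.
have szK : (K * (2 * k).+2).+2 <= size s2 by apply: leq_trans sz2; apply: leq_addr.
have := pairwise_relI (fun w w' => if d1 then Y w.1 < Y w'.1 else Y w'.1 < Y w.1)%R
  (fun w w' => if d2 then Y w.2 < Y w'.2 else Y w'.2 < Y w.2)%R s2.
rewrite m1 m2 {m1 m2}; case: d1; case: d2 => /= pr.
- by apply: (@parallel_good _ X Y k s2); [split|apply: ltnW].
(* This wedge opens to the right. A half turn exchanges the two rows and reverses the list. *)
- have sh' : short K (fun t => - X t)%R (fun t => - Y t)%R.
    by move=> a b ab; rewrite (level_transfer (cut_opp2 X Y)) sh.
  apply: (good_transfer (cut_opp2 X Y)).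
  apply: (@wedge_good _ _ _ k1 _ _ (rev (map (fun w => (w.2, w.1)) s2)) sh').
    have [a1 a2 a3] := al2; split; first split.
    + by move=> w; rewrite mem_rev => /mapP[[u b] /a1 /= h ->] /=; order_lia.
    + by rewrite pairwise_rev pairwise_map; apply: sub_pairwise a2 => -[u b] [u' b'] /=; lia.
    + move=> w w'; rewrite !mem_rev => /mapP[[u b] vs ->] /mapP[[u' b'] vs' ->].
      by have := a3 _ _ vs' vs; rewrite /=; order_lia.
    + by rewrite pairwise_rev pairwise_map; apply: sub_pairwise pr => -[u b] [u' b'] /=; lia.
  by rewrite size_rev size_map.
- by apply: (wedge_good k1 sh (s := s2)).
(* Both rows fall. Reflection makes them rise, at the cost of one pair. *)
case: s2 => [|w0 s2] in ss2 sz2 szk szK al2 pr *; first by [].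
apply: (good_transfer (cut_oppr X Y)).
apply: (parallel_good (shift_pairs_parallel al2 pr)).
by rewrite size_pairmap.
Qed.

(** * Few steps *)

(** Choose some [b] for the first element and discard everything [b] hits, fewer than [N] elements;
    what is chosen later is then not hit by [b]. *)
Lemma greedy (A B : eqType) (h : B -> pred A) N m (F : seq A) :
  0 < N -> (forall b, count (h b) F < N) ->
  {in F, forall a, exists b, h b a} -> m * N <= size F ->
  exists L : seq (B * A), [/\ size L = m,
    {in L, forall l : B * A, l.2 \in F /\ h l.1 l.2}
    & pairwise (fun l l' => ~~ h l.1 l'.2) L].
Proof.
move=> N0; elim: m F => [|m IH] F hN hF sz; first by exists [::].
case: F => [|a F] in hN hF sz *; first by move: N0 sz => /=; lia.
set G := a :: F in hN hF sz *.
have [b ba] := hF a (mem_head _ _).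
have szG : size (filter (predC (h b)) G) = size G - count (h b) G.
  by rewrite size_filter -(count_predC (h b) G) addKn.
have [c|c cG||L [sL hL pL]] := IH (filter (predC (h b)) G).
- apply: leq_ltn_trans (hN c).
  by apply: leq_count_subseq; apply: filter_subseq.
- by apply: hF; move: cG; rewrite mem_filter => /andP[].
- by rewrite szG; move: (hN b) sz; rewrite mulSn; lia.
exists ((b, a) :: L); split=> /=; first by rewrite sL.
- move=> l; rewrite inE => /predU1P[->|/hL[]]; first by rewrite mem_head.
  by rewrite mem_filter => /andP[].
rewrite pL andbT; apply/allP=> l /hL[].
by rewrite mem_filter => /andP[].
Qed.

Section Hits.

Variable T : finType.
Implicit Types (X Y : T -> int) (A : {set T}) (s F : seq (T * T)) (w P : T * T)
  (l : T * (T * T)).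

Lemma short_transfer K X Y X' Y' :
  (forall z (A : {set T}), cut X' Y' z A = cut X Y z A) ->
  short K X Y -> short K X' Y'.
Proof. by move=> e sh a b ab; rewrite (level_transfer e) sh. Qed.

Lemma alternation_map (L : seq (T * (T * T))) X Y (g : T * (T * T) -> T) :
  {in L, forall l, (X (g l) < X l.1)%R} ->
  pairwise (fun l l' => (X l.1 < X (g l'))%R) L ->
  {in L &, forall l l', (Y l.1 < Y (g l'))%R} ->
  alternation X Y (map (fun l => (g l, l.1)) L).
Proof.
move=> h1 h2 h3; split.
- by move=> w /mapP[l /h1 h ->].
- by rewrite pairwise_map.
- by move=> w w' /mapP[l ls ->] /mapP[l' ls' ->]; apply: h3.
Qed.

(** This is the case of a previous point [u] where [x] lies above level [t]; the other three
    directions arise by changing the coordinates. *)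
Definition hit X Y t x u P : bool :=
  [&& (Y x < Y u)%R, [forall w in level X Y t P.1 P.2, (Y w < Y x)%R] &
      u \in level X Y t.+1 P.1 P.2].

End Hits.

(** Each chosen [u] is above its own level, so it cuts that level by abscissa. It does not cut the
    levels chosen later, so each of them lies entirely on one side of [u]. Once the [u] are monotone
    in abscissa, one point from each level alternates with them, with [x] between the two rows. *)
Lemma hits_good k K : 1 < k -> exists m, forall (T : finType) (X Y : T -> int),
  injective X -> injective Y -> short K X Y ->
  forall t x (F : seq (T * T)) N,
    (forall u, count (hit X Y t x u) F < N) ->
    {in F, forall P, exists u, hit X Y t x u P} ->
    m * N <= size F -> good X Y k.
Proof.
move=> k1; have [N0 alt] := alternation_good K k1; have [m R] := ramsey N0 N0.
exists m => T X Y injX injY sh t x F N cN hF sz.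
have [L [sL hL pL]] := greedy (leq_ltn_trans (leq0n _) (cN x)) cN hF sz.
have {}hL (l : T * (T * T)) : l \in L -> hit X Y t x l.1 l.2 by move=> /hL[].
have between (l : T * (T * T)) : l \in L -> exists e f, [/\ e \in level X Y t l.2.1 l.2.2,
    f \in level X Y t l.2.1 l.2.2 & (X e < X l.1 < X f)%R].
  move=> /hL/and3P[xu /forall_inP lx]; rewrite in_setU inE => /orP[ul|].
    by have := lx _ ul; order_lia.
  case/cutP=> e [f [eA fA h]]; exists e, f; split=> //.
  by case/orP: h => // h; have := lx _ fA; order_lia.
have jump (l l' : T * (T * T)) e f : l \in L -> l' \in L -> ~~ hit X Y t x l.1 l'.2 ->
    e \in level X Y t l'.2.1 l'.2.2 -> f \in level X Y t l'.2.1 l'.2.2 ->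
    ~~ (X e < X l.1 < X f)%R.
  move=> /hL/and3P[xu _ _] /hL/and3P[_ lx _]; rewrite /hit xu lx /=.
  move=> nu eA fA; apply: contraNN nu => h; rewrite in_setU inE.
  by apply/orP; right; apply: cutX h.
have below (l l' : T * (T * T)) e : l \in L -> l' \in L -> e \in level X Y t l'.2.1 l'.2.2 ->
    (Y e < Y l.1)%R.
  move=> /hL/and3P[xu _ _] /hL/and3P[_ /forall_inP lx _] /lx h.
  by order_lia.
have neqX (l l' : T * (T * T)) e : l \in L -> l' \in L -> e \in level X Y t l'.2.1 l'.2.2 ->
    X e != X l.1.
  by move=> ls ls' /(below _ _ _ ls ls'); apply: contraTneq => /injX->; order_lia.
have := R _ (fun l l' : T * (T * T) => X l.1 < X l'.1)%R L; rewrite sL => /(_ (leqnn m)).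
case=> -[L1 [ss1 sz1 p1]].
  have mL := mem_subseq ss1.
  (* For [l] in [L] the default is never taken, by [between]. *)
  pose g (l : T * (T * T)) := odflt l.1 [pick e in level X Y t l.2.1 l.2.2 | (X e < X l.1)%R].
  have gP (l : T * (T * T)) : l \in L -> g l \in level X Y t l.2.1 l.2.2 /\ (X (g l) < X l.1)%R.
    move=> /between[e [f [eA fA /andP[h _]]]]; rewrite /g; case: pickP => /= [c /andP[]//|/(_ e)].
    by rewrite eA h.
  apply: (good_transfer (cut_oppr X Y)).
  apply: (alt _ _ _ (map (fun l => (g l, l.1)) L1)); last by rewrite size_map.
  - by move=> a b /GRing.oppr_inj/injY.
  - exact: short_transfer (cut_oppr X Y) sh.
  apply: alternation_map.
  - by move=> l /mL/gP[].
  - have := pairwise_relI (fun l l' : T * (T * T) => X l.1 < X l'.1)%R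
      (fun l l' : T * (T * T) => ~~ hit X Y t x l.1 l'.2) L1.
    rewrite p1 (subseq_pairwise ss1 pL); apply: sub_in_pairwise_mem.
    move=> l l' /mL ls /mL ls' /andP[c nh].
    have [e [f [_ fA ef]]] := between _ ls'; have [gA gu] := gP _ ls'.
    have := jump _ _ _ _ ls ls' nh gA fA; have := neqX _ _ _ ls ls' gA.
    by move: c ef gu => /=; clear; lia.
  - move=> l l' /mL ls /mL ls'; have [gA gu] := gP _ ls'.
    by have := below _ _ _ ls ls' gA; order_lia.
(* The points [u] now go from right to left, so the companion is taken on the right of [u]. *)
have mL := mem_subseq ss1.
pose g (l : T * (T * T)) := odflt l.1 [pick e in level X Y t l.2.1 l.2.2 | (X l.1 < X e)%R].
have gP (l : T * (T * T)) : l \in L -> g l \in level X Y t l.2.1 l.2.2 /\ (X l.1 < X (g l))%R.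
  move=> /between[e [f [eA fA /andP[_ h]]]]; rewrite /g; case: pickP => /= [c /andP[]//|/(_ f)].
  by rewrite fA h.
apply: (good_transfer (cut_opp2 X Y)).
apply: (alt _ _ _ (map (fun l => (g l, l.1)) L1)); last by rewrite size_map.
- by move=> a b /GRing.oppr_inj/injY.
- exact: short_transfer (cut_opp2 X Y) sh.
apply: alternation_map.
- by move=> l /mL/gP[_]; order_lia.
- have := pairwise_relI (fun l l' : T * (T * T) => ~~ (X l.1 < X l'.1)%R)
    (fun l l' : T * (T * T) => ~~ hit X Y t x l.1 l'.2) L1.
  rewrite p1 (subseq_pairwise ss1 pL); apply: sub_in_pairwise_mem.
  move=> l l' /mL ls /mL ls' /andP[c nh].
  have [e [f [eA _ ef]]] := between _ ls'; have [gA gu] := gP _ ls'.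
  have := jump _ _ _ _ ls ls' nh eA gA; have := neqX _ _ _ ls ls' gA.
  by move: c ef gu => /=; clear; lia.
- move=> l l' /mL ls /mL ls'; have [gA gu] := gP _ ls'.
  by have := below _ _ _ ls ls' gA; order_lia.
Qed.

(** The separator [u] differs from level [t] in one of the two coordinates; in that coordinate [x]
    has all of level [t] on one side and [u] on the other. *)
Lemma hit_exists (T : finType) (X Y : T -> int) t x (P : T * T) :
  injective X -> injective Y ->
  x \in level X Y t.+2 P.1 P.2 -> x \notin level X Y t.+1 P.1 P.2 ->
  exists u, [|| hit X Y t x u P, hit X (fun t => - Y t)%R t x u P,
                hit Y X t x u P | hit Y (fun t => - X t)%R t x u P].
Proof.
move=> injX injY xl xn; have [u [ul uP lev]] := level_separator injX injY xl xn.
have nx w : w \in level X Y t.+1 P.1 P.2 -> w != x by apply: contraTneq => ->.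
have nt w : w \in level X Y t P.1 P.2 -> w != x.
  by move=> wl; apply: nx; apply: (subsetP (level_sub X Y _ _ (leqnSn t))).
exists u; have ux := nx _ ul; have [P1 _] := level0 X Y t P.1 P.2.
have mk (X' Y' : T -> int) : (forall z (A : {set T}), cut X' Y' z A = cut X Y z A) ->
    (Y' x < Y' u)%R -> {in level X Y t P.1 P.2, forall w, (Y' w < Y' x)%R} ->
    hit X' Y' t x u P.
  move=> e xu lx; rewrite /hit xu !(level_transfer e) ul andbT /=.
  by apply/forall_inP.
have neX w : w != x -> X w != X x by rewrite (inj_eq injX).
have neY w : w != x -> Y w != Y x by rewrite (inj_eq injY).
have sX w : w \in level X Y t P.1 P.2 -> (X w < X x)%R = (X P.1 < X x)%R.
  by case/lev.
have sY w : w \in level X Y t P.1 P.2 -> (Y w < Y x)%R = (Y P.1 < Y x)%R.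
  by case/lev.
have dX := neX _ ux; have dY := neY _ ux.
move: uP; rewrite xpair_eqE negb_and => /orP[] ne.
  have [a|a] := boolP (X P.1 < X x)%R.
    rewrite (mk Y X) ?orbT //; first by move=> z A; rewrite cut_swap.
      by move: ne dX; rewrite a; clear; lia.
    by move=> w /sX->.
  rewrite (mk Y (fun t => - X t)%R) ?orbT //.
  - by move=> z A; rewrite cut_oppr cut_swap.
  - by move: ne; rewrite (negbTE a); clear; lia.
  - by move=> w wl; have := neX _ (nt _ wl); have := sX _ wl; rewrite (negbTE a);
      clear; lia.
have [a|a] := boolP (Y P.1 < Y x)%R.
  rewrite (mk X Y) //; first by move: ne dY; rewrite a; clear; lia.
  by move=> w /sY->.
rewrite (mk X (fun t => - Y t)%R) ?orbT //.
- by move=> z A; rewrite cut_oppr.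
- by move: ne; rewrite (negbTE a); clear; lia.
- by move=> w wl; have := neY _ (nt _ wl); have := sY _ wl; rewrite (negbTE a);
    clear; lia.
Qed.

(** Neighbours in abscissa can be cut directly only by ordinate; this is what makes the first step
    analysable. *)
Definition adjacent_pairs (T : finType) (X : T -> int) (F : seq (T * T)) : Prop :=
  [/\ {in F, forall P : T * T, (X P.1 < X P.2)%R},
      {in F, forall (P : T * T) z, ~~ (X P.1 < X z < X P.2)%R}
    & pairwise (fun P P' : T * T => (X P.2 < X P'.1)%R) F].

Lemma adjacent_pairs_sub (T : finType) (X : T -> int) (F G : seq (T * T)) :
  subseq G F -> adjacent_pairs X F -> adjacent_pairs X G.
Proof.
move=> ss [a1 a2 a3]; have m := mem_subseq ss; split.
- by move=> P /m; apply: a1.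
- by move=> P /m; apply: a2.
- exact: subseq_pairwise a3.
Qed.

(** The ordinate of [x] separates the points of every pair. Pairs whose right point is below [x]
    form an alternation, and so do the others after reflection. *)
Lemma level1_good k K : 1 < k -> exists N, forall (T : finType) (X Y : T -> int)
    (F : seq (T * T)) x,
  injective Y -> short K X Y -> adjacent_pairs X F -> N <= size F ->
  {in F, forall P : T * T, cut X Y x [set P.1; P.2]} -> good X Y k.
Proof.
move=> k1; have [N alt] := alternation_good K k1; exists (N + N).
move=> T X Y F x injY sh [a1 a2 a3] sz hF.
have sep (P : T * T) : P \in F -> (Y P.1 < Y x < Y P.2)%R || (Y P.2 < Y x < Y P.1)%R.
  move=> PF; have /cutP[e [f [eP fP h]]] := hF _ PF.
  have := a1 _ PF; have := a2 _ PF x.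
  move: eP fP; rewrite !inE => /orP[]/eqP ee /orP[]/eqP ef; move: h; rewrite ee ef;
    clear; lia.
pose c (P : T * T) := (Y P.2 < Y x)%R.
have szc : size (filter c F) + size (filter (predC c) F) = size F.
  by rewrite !size_filter count_predC.
have [l1|l1] := leqP N (size (filter c F)).
  apply: (alt _ X Y (filter c F)) => //; split.
  - by move=> P; rewrite mem_filter => /andP[_ /a1].
  - by apply: subseq_pairwise a3; apply: filter_subseq.
  - move=> P P'; rewrite !mem_filter => /andP[h PF] /andP[h' PF'].
    by move: (sep _ PF) (sep _ PF') h h'; rewrite /c; clear; lia.
apply: (good_transfer (cut_oppr X Y)).
apply: (alt _ _ _ (filter (predC c) F)); last by lia.
- by move=> a b /GRing.oppr_inj/injY.
- exact: short_transfer (cut_oppr X Y) sh.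
split.
- by move=> P; rewrite mem_filter => /andP[_ /a1].
- by apply: subseq_pairwise a3; apply: filter_subseq.
- move=> P P'; rewrite !mem_filter => /andP[h PF] /andP[h' PF'].
  by move: (sep _ PF) (sep _ PF') h h'; rewrite /= /c; clear; lia.
Qed.

(** Induction on the number of steps: a point [u] that serves many pairs takes the place of [x] with
    one step less, and otherwise many different [u] are covered by [hits_good]. *)
Lemma converging_good k K t : 1 < k -> exists N,
  forall (T : finType) (X Y : T -> int) (F : seq (T * T)) x,
  injective X -> injective Y -> short K X Y -> adjacent_pairs X F -> N <= size F ->
  {in F, forall P : T * T, (x \in level X Y t P.1 P.2) && (x \notin [set P.1; P.2])} ->
  good X Y k.
Proof.
move=> k1; elim: t => [|t [N IH]].
  exists 1 => T X Y [|P F] x injX injY sh aF // _ hF.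
  by have := hF P (mem_head _ _); rewrite /level /= andbN.
(* Pairs that reach [x] a step earlier fall under the induction hypothesis, so only those that need
   the last step matter. *)
have split_last (M : nat) : (forall (T : finType) (X Y : T -> int) (F : seq (T * T)) x,
    injective X -> injective Y -> short K X Y -> adjacent_pairs X F -> M <= size F ->
    {in F, forall P : T * T, (x \in level X Y t.+1 P.1 P.2) && (x \notin level X Y t P.1 P.2)} ->
    good X Y k) ->
  exists N, forall (T : finType) (X Y : T -> int) (F : seq (T * T)) x,
    injective X -> injective Y -> short K X Y -> adjacent_pairs X F -> N <= size F ->
    {in F, forall P : T * T, (x \in level X Y t.+1 P.1 P.2) && (x \notin [set P.1; P.2])} ->
    good X Y k.
  move=> hM; exists (N + M) => T X Y F x injX injY sh aF sz hF.
  pose c (P : T * T) := x \in level X Y t P.1 P.2.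
  have szc : size (filter c F) + size (filter (predC c) F) = size F.
    by rewrite !size_filter count_predC.
  have [l1|l1] := leqP N (size (filter c F)).
    apply: (IH _ _ _ (filter c F) x) => //.
      by apply: adjacent_pairs_sub aF; apply: filter_subseq.
    by move=> P; rewrite mem_filter => /andP[cP /hF/andP[_ ->]]; rewrite andbT.
  apply: (hM _ _ _ (filter (predC c) F) x) => //.
  - by apply: adjacent_pairs_sub aF; apply: filter_subseq.
  - by lia.
  - by move=> P; rewrite mem_filter => /andP[cP /hF/andP[-> _]].
case: t => [|t] in IH split_last *.
  have [M hM] := level1_good K k1; apply: (split_last M).
  move=> T X Y F x injX injY sh aF sz hF; apply: (hM _ _ _ F x) => // P /hF.
  move=> /andP[xl /negbTE xn]; move: xl.
  by rewrite [level _ _ _ _ _]/(_ :|: _) in_setU xn inE.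
(* The factor 4 is the pigeonhole principle over the four directions of [hit_exists]. *)
have [m hm] := hits_good K k1; apply: (split_last (4 * (m * N))).
move=> T X Y F x injX injY sh aF sz hF.
have dir (X' Y' : T -> int) : (forall z (A : {set T}), cut X' Y' z A = cut X Y z A) ->
    injective X' -> injective Y' ->
    m * N <= count (fun P => [exists u, hit X' Y' t x u P]) F -> good X Y k.
  move=> e injX' injY'; rewrite -size_filter; set G := filter _ F => szG.
  have ssG : subseq G F by apply: filter_subseq.
  have [[u uN]|nu] := classic (exists u, N <= count (hit X' Y' t x u) G).
    apply: (IH _ X Y (filter (hit X' Y' t x u) G) u) => //.
    - by apply: adjacent_pairs_sub aF; apply: subseq_trans (filter_subseq _ _) ssG.
    - by rewrite size_filter.
    move=> P; rewrite mem_filter => /andP[/and3P[xu /forall_inP lx]].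
    rewrite (level_transfer e) => -> _ /=; rewrite !inE negb_or.
    have [p1 p2] := level0 X' Y' t P.1 P.2; have := lx _ p1; have := lx _ p2 => h1 h2.
    by apply/andP; split; [apply: contraTneq h2|apply: contraTneq h1] => <-;
      rewrite -Order.TotalTheory.leNgt Order.POrderTheory.ltW.
  apply: (good_transfer e).
  apply: (hm T X' Y' injX' injY' (short_transfer e sh) t x G N) => //.
    by move=> u; rewrite ltnNge; apply/negP=> h; apply: nu; exists u.
  by move=> P; rewrite mem_filter => /andP[/existsP].
have oX : injective (fun t => - X t)%R by move=> a b /GRing.oppr_inj/injX.
have oY : injective (fun t => - Y t)%R by move=> a b /GRing.oppr_inj/injY.
pose d1 P := [exists u, hit X Y t x u P].
pose d2 P := [exists u, hit X (fun t => - Y t)%R t x u P].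
pose d3 P := [exists u, hit Y X t x u P].
pose d4 P := [exists u, hit Y (fun t => - X t)%R t x u P].
have cover : size F <= count d1 F + count d2 F + count d3 F + count d4 F.
  have : {in F, forall P : T * T, [|| d1 P, d2 P, d3 P | d4 P]}.
    move=> P /hF/andP[xl xn]; have [u] := hit_exists injX injY xl xn.
    rewrite /d1 /d2 /d3 /d4.
    by case/or4P=> h; apply/or4P; [constructor 1|constructor 2|constructor 3|constructor 4];
      apply/existsP; exists u.
  elim: (F) => //= P F' IHF hF'.
  have {}IHF := IHF (fun Q QF => hF' Q (@mem_behead _ (P :: F') Q QF)).
  move: IHF.
  have := hF' P (mem_head _ _); clear; case: (d1 P); case: (d2 P); case: (d3 P);
    case: (d4 P) => //= _; lia.
have [l1|l1] := leqP (m * N) (count d1 F); first by apply: (dir X Y).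
have [l2|l2] := leqP (m * N) (count d2 F).
  by apply: (dir X (fun t => - Y t)%R) => // z A; rewrite cut_oppr.
have [l3|l3] := leqP (m * N) (count d3 F).
  by apply: (dir Y X) => // z A; rewrite cut_swap.
apply: (dir Y (fun t => - X t)%R) => // [z A|]; first by rewrite cut_oppr cut_swap.
by move: sz cover l1 l2 l3; rewrite /d4; clear; lia.
Qed.

(** * Permutations *)

Section Permutations.

Variables (n : nat) (p : 'S_n).

Definition abscissa (i : 'I_n) : int := Posz i.
Definition ordinate (i : 'I_n) : int := Posz (p i).

Lemma abscissa_inj : injective abscissa.
Proof. by move=> i j [] /val_inj. Qed.

Lemma ordinate_inj : injective ordinate.
Proof. by move=> i j [] /val_inj/perm_inj. Qed.

Lemma convex_contiguous m (A : {set 'I_m}) :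
  (forall a b c : 'I_m, a \in A -> b \in A -> a < c < b -> c \in A) -> contiguous A.
Proof.
move=> conv; have [->|[i0 iA]] := set_0Vmem A.
  by exists 1, 0; apply/setP=> i; rewrite !inE; lia.
case: (arg_minnP (fun i : 'I_m => i : nat) iA) => a aA amin.
case: (arg_maxnP (fun i : 'I_m => i : nat) iA) => b bA bmax.
exists a, b; apply/setP=> i; rewrite inE; apply/idP/andP.
  by move=> iA'; split; [exact: amin|exact: bmax].
move=> [ai ib]; have [->//|na] := eqVneq i a; have [->//|nb] := eqVneq i b.
apply: (conv a b) => //; move: na nb ai ib; rewrite -!val_eqE /=; clear; lia.
Qed.

Lemma contiguous_convex m (A : {set 'I_m}) (a b c : 'I_m) :
  contiguous A -> a \in A -> b \in A -> a < c < b -> c \in A.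
Proof. by move=> [x [y ->]]; rewrite !inE; lia. Qed.

(** A set that no outside point cuts contains all indices, and the preimages of all values, between
    two of its own. *)
Lemma simple_perm_setT : simple_perm p -> simple abscissa ordinate setT.
Proof.
move=> sp M [_ cM] M2; have ccM z : cut abscissa ordinate z M -> z \in M.
  exact: cM.
have : #|M| \in [:: 0; 1; n].
  apply: sp; split; apply: convex_contiguous => a b c.
    by move=> aM bM h; apply: ccM; apply: cutX aM bM _.
  move=> /imsetP[i iM ->] /imsetP[j jM ->] h.
  rewrite -(permKV p c); apply: imset_f; apply: ccM; apply: cutY iM jM _.
  by rewrite /ordinate permKV.
rewrite !inE => /or3P[/eqP h|/eqP h|/eqP h]; [by rewrite h in M2|by rewrite h in M2|].
by apply/eqP; rewrite eqEcard subsetT cardsT card_ord h /=.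
Qed.

Lemma pairwise_enum (S : {set 'I_n}) : pairwise (fun i j : 'I_n => i < j) (enum S).
Proof.
have : pairwise (fun i j : 'I_n => i < j) (enum 'I_n).
  have := iota_ltn_sorted 0 n; rewrite -val_enum_ord sorted_pairwise ?pairwise_map //.
  exact: ltn_trans.
by apply: subseq_pairwise; rewrite enumT; apply: filter_subseq.
Qed.

(** The permutation order isomorphic to the subsequence sends a position to the number of smaller
    entries. Its intervals, carried into [S] by the increasing enumeration [e], are modules of
    [S]. *)
Lemma simple_subsequence (S : {set 'I_n}) :
  simple abscissa ordinate S -> simple_seq (subsequence p S).
Proof.
move=> sS; set s := subsequence p S.
have szs : size s = #|S| by rewrite size_map -cardE.
(* The empty set is treated apart because [nth] needs a default index. *)
have [S0|[x0 x0S]] := set_0Vmem S.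
  have s0 : size s = 0 by rewrite szs S0 cards0.
  have no (i : 'I_(size s)) : False by case: i => i; rewrite s0.
  exists 1%g => [i|I _]; first by case: (no i).
  have -> : I = set0 by apply/setP=> i; case: (no i).
  by rewrite cards0.
pose e (i : 'I_(size s)) := nth x0 (enum S) i.
have szE (i : 'I_(size s)) : i < size (enum S) by rewrite -cardE -szs.
have eS i : e i \in S by rewrite -mem_enum mem_nth.
have se (i : 'I_(size s)) : nth 0 s i = p (e i) by rewrite (nth_map x0).
have e_lt (i j : 'I_(size s)) : i < j -> e i < e j.
  move=> ij; have /(pairwiseP x0) h := pairwise_enum S.
  by apply: (h i j); rewrite ?inE ?szE.
have eE (i j : 'I_(size s)) : (e i < e j) = (i < j).
  case: (ltngtP i j) => [ij|ji|/val_inj->]; last by rewrite ltnn.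
    exact: e_lt.
  by apply: negbTE; rewrite -leqNgt ltnW ?e_lt.
have e_inj : injective e.
  by move=> i j eij; case: (ltngtP i j) => [/e_lt|/e_lt|/val_inj//]; rewrite eij ltnn.
have e_onto z : z \in S -> exists i, z = e i.
  rewrite -mem_enum => zS; have iz : index z (enum S) < size s.
    by rewrite szs cardE index_mem.
  by exists (Ordinal iz); rewrite /e nth_index.
pose below (i : 'I_(size s)) := [set j : 'I_(size s) | nth 0 s j < nth 0 s i].
have below_lt (i : 'I_(size s)) : #|below i| < size s.
  rewrite -[X in _ < X]card_ord; apply: proper_card; apply/properP; split.
    exact: subset_predT.
  by exists i; rewrite ?inE ?ltnn.
pose r (i : 'I_(size s)) := Ordinal (below_lt i).
have r_lt (i j : 'I_(size s)) : nth 0 s i < nth 0 s j -> r i < r j.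
  move=> ij; apply: proper_card; apply/properP; split.
    by apply/subsetP=> l; rewrite !inE => /ltn_trans; apply.
  by exists i; rewrite !inE ?ltnn.
have rE (i j : 'I_(size s)) : (nth 0 s i < nth 0 s j) = (r i < r j).
  case: (ltngtP (nth 0 s i) (nth 0 s j)) => [ij|ji|].
  - by rewrite r_lt.
  - by apply/esym/negbTE; rewrite -leqNgt ltnW ?r_lt.
  - by rewrite !se => /val_inj/perm_inj/e_inj->; rewrite ltnn.
have r_inj : injective r.
  move=> i j rij; case: (ltngtP (nth 0 s i) (nth 0 s j)) => [/r_lt|/r_lt|].
  - by rewrite rij ltnn.
  - by rewrite rij ltnn.
  - by rewrite !se => /val_inj/perm_inj/e_inj.
exists (perm r_inj) => [i j|I [cI cqI]]; first by rewrite !permE rE.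
have card_eI : #|e @: I| = #|I| by rewrite card_imset.
have mI : module abscissa ordinate S (e @: I).
  split; first by apply/subsetP=> _ /imsetP[i _ ->].
  move=> z /e_onto[l ->] /cutP[_ [_ [/imsetP[i iI ->] /imsetP[j jI ->] /orP[h|h]]]].
    by apply: imset_f; apply: (contiguous_convex cI iI jI); rewrite -!eE.
  apply: imset_f; rewrite -(mem_imset _ _ (@perm_inj _ (perm r_inj))).
  apply: (contiguous_convex cqI (imset_f _ iI) (imset_f _ jI)).
  by rewrite !permE -!rE !se.
rewrite !inE; have [lt|] := ltnP 1 #|e @: I|; last by rewrite card_eI; lia.
by rewrite -card_eI (sS _ mI lt) szs eqxx !orbT.
Qed.

Lemma size_subsequence (S : {set 'I_n}) : size (subsequence p S) = #|S|.
Proof. by rewrite size_map -cardE. Qed.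

End Permutations.

(** Either some pair needs more than [K] steps and gives a long pin sequence, or index 0 is reached
    within [K] steps from each of the disjoint pairs of neighbours (1, 2), (3, 4), and so on. *)
Lemma simple_perm_good k : exists N, forall (n : nat) (p : 'S_n),
  simple_perm p -> N <= n -> good (@abscissa n) (ordinate p) k.+3.
Proof.
pose K := 2 * (k.+3 + 2); have [N conv] := @converging_good k.+3 K K isT.
exists (2 * N).+3 => n p sp szn; have sT := simple_perm_setT sp.
have iX := @abscissa_inj n; have iY := @ordinate_inj n p.
have [[a [b [ab h]]]|nlong] := classic (exists a b : 'I_n, a != b /\
    level (@abscissa n) (ordinate p) K a b != setT).
  by apply: (long_level_good iX iY sT ab _ _ h); rewrite // /K; lia.
have sh : short K (@abscissa n) (ordinate p).
  by move=> a b ab; apply/eqP/negPn/negP=> h; apply: nlong; exists a, b.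
case: n => [//|n] in p sp szn sT iX iY nlong sh *.
have [P PE] : exists P : nat -> 'I_n.+1 * 'I_n.+1, forall i, i < N ->
    (P i).1 = i.*2.+1 :> nat /\ (P i).2 = i.*2.+2 :> nat.
  exists (fun i => (inord i.*2.+1, inord i.*2.+2)) => i iN.
  by rewrite !inordK; lia.
apply: (conv _ _ _ (map P (iota 0 N)) ord0 iX iY sh) => //; last first.
- move=> _ /mapP[i iN ->]; rewrite mem_iota in iN.
  have [e1 e2] := PE i iN; rewrite sh ?in_setT /=; last first.
    by rewrite -val_eqE /= e1 e2; clear; lia.
  by rewrite in_set2 negb_or -!val_eqE /= e1 e2.
- by rewrite size_map size_iota.
split.
- move=> _ /mapP[i iN ->]; rewrite mem_iota in iN.
  by have [e1 e2] := PE i iN; rewrite /abscissa ?e1 ?e2; lia.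
- move=> _ /mapP[i iN ->] z; rewrite mem_iota in iN.
  by have [e1 e2] := PE i iN; rewrite /abscissa ?e1 ?e2; lia.
rewrite pairwise_map; have := iota_ltn_sorted 0 N.
rewrite sorted_pairwise; last exact: ltn_trans.
apply: sub_in_pairwise_mem => i j; rewrite !mem_iota => /PE[e1 e2] /PE[e3 e4] ij /=.
by rewrite /abscissa e2 e3; lia.
Qed.

Theorem theorem1p1 :
  exists f : nat -> nat,
    forall k : nat, 0 < k ->
    forall (n : nat) (p : 'S_n), simple_perm p -> f k <= n ->
    exists S T : {set 'I_n},
      [/\ S != T,
          simple_seq (subsequence p S) /\ k <= size (subsequence p S),
          simple_seq (subsequence p T) /\ k <= size (subsequence p T)
        & #|S :&: T| <= 2].
Proof.
(* The bound for [k + 3] serves for [k]: the constructions need at least three points, and two equal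
   sets of that size would share more than two. *)
exists (fun k => proj1_sig (constructive_indefinite_description _ (simple_perm_good k))).
move=> k _ n p sp; case: constructive_indefinite_description => N hN /= /(hN _ _ sp).
move=> [S [T [[sS kS] [sT kT] ST]]]; exists S, T; rewrite !size_subsequence.
have leS : k <= #|S| by apply: leq_trans kS; rewrite -addn3 leq_addr.
have leT : k <= #|T| by apply: leq_trans kT; rewrite -addn3 leq_addr.
split=> //; [|split=> //; exact: simple_subsequence|split=> //; exact: simple_subsequence].
by apply: contraTneq ST => <-; rewrite setIid -ltnNge; lia.
Qed.
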